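(* Let $S=(\mathcal S,\mathcal A,\mathcal R)$ be a functional PTS specification, let $\Gamma$ be a context of $\lambda S$ and let $A$ be a $\Gamma$-type of $\lambda S$. If there is a term $N$ such that $\|\Gamma\| \vdash_{\lambda\Pi/S} N : \|A\|_{\Gamma}$, then there is a term $M$ such that $\Gamma \vdash_{\lambda S} M : A$.
   Context: Pure type systems. A PTS specification is $S=(\mathcal S,\mathcal A,\mathcal R)$ with $\mathcal S$ a set of sorts, $\mathcal A\subseteq\mathcal S\times\mathcal S$ a set of axioms written $(s_1:s_2)$, and $\mathcal R\subseteq \mathcal S\times\mathcal S\times\mathcal S$ a set of rules; $(s_1,s_2)$ abbreviates $(s_1,s_2,s_2)$. $S$ is functional if $(s_1:s_2),(s_1:s_2')\in\mathcal A$ imply $s_2=s_2'$ and $(s_1,s_2,s_3),(s_1,s_2,s_3')\in\mathcal R$ imply $s_3=s_3'$. Terms are $T::= s\mid x\mid T\,T\mid \lambda x:T.\,T\mid \Pi x:T.\,T$ ($s$ a sort, $x$ a variable); contexts are lists $x_1:A_1,\dots,x_n:A_n$; $A\to B$ denotes $\Pi x:A.B$ with $x$ not free in $B$. The typing rules of $\lambda S$ (judgments $\mathrm{WF}(\Gamma)$ and $\Gamma\vdash M:A$) are: $\mathrm{WF}(\cdot)$; if $\Gamma\vdash A:s$ and $x\notin\Gamma$ then $\mathrm{WF}(\Gamma,x:A)$; if $\mathrm{WF}(\Gamma)$ and $(x:A)\in\Gamma$ then $\Gamma\vdash x:A$; if $\mathrm{WF}(\Gamma)$ and $(s_1:s_2)\in\mathcal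 A$ then $\Gamma\vdash s_1:s_2$; if $\Gamma\vdash A:s_1$, $\Gamma,x:A\vdash B:s_2$ and $(s_1,s_2,s_3)\in\mathcal R$ then $\Gamma\vdash \Pi x:A.B:s_3$; if $\Gamma,x:A\vdash M:B$ and $\Gamma\vdash\Pi x:A.B:s$ then $\Gamma\vdash\lambda x:A.M:\Pi x:A.B$; if $\Gamma\vdash M:\Pi x:A.B$ and $\Gamma\vdash N:A$ then $\Gamma\vdash M\,N:B[N/x]$; if $\Gamma\vdash M:A$, $\Gamma\vdash B:s$ and $A\equiv_\beta B$ then $\Gamma\vdash M:B$. A $\Gamma$-term is an $M$ with $\mathrm{WF}(\Gamma)$ and $\Gamma\vdash M:A$ for some $A$; a $\Gamma$-type is an $A$ with $\mathrm{WF}(\Gamma)$ and either $\Gamma\vdash A:s$ or $A=s$ for some sort $s$. The $\lambda\Pi$ calculus modulo rewriting. $\lambda\Pi$ is the PTS with sorts $\mathsf{Type},\mathsf{Kind}$, axiom $\mathsf{Type}:\mathsf{Kind}$ and rules $(\mathsf{Type},\mathsf{Type}),(\mathsf{Type},\mathsf{Kind})$. Given a well-formed $\lambda\Pi$ context $\Sigma$ and a set $R$ of rewrite rules $[\Delta]\,M\leadsto N$, $\longrightarrow_R$ is the contextual closure of $\sigma(M)\longrightarrow_R\sigma(N)$ for substitutions $\sigma$ of the variables of $\Delta$, $\longrightarrow_{\beta R}=\longrightarrow_\beta\cup\longrightarrow_R$, and $\equiv_{\beta R}$ is the generated congruence. $\lambda\Pi/(\Sigma,R)$ has the typing rules of $\lambda\Pi$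 except that declarations require $x\notin\Sigma,\Gamma$, the variable rule allows $(x:A)\in\Sigma,\Gamma$, and conversion uses $\equiv_{\beta R}$ instead of $\equiv_\beta$. The system $\lambda\Pi/S$ is $\lambda\Pi/(\Sigma_S,R_S)$ where $\Sigma_S$ declares: $u_s:\mathsf{Type}$ and $\varepsilon_s:u_s\to\mathsf{Type}$ for each $s\in\mathcal S$; $\dot s_1:u_{s_2}$ for each $(s_1:s_2)\in\mathcal A$; $\dot\pi_{s_1s_2s_3}:\Pi\alpha:u_{s_1}.\,(\varepsilon_{s_1}\alpha\to u_{s_2})\to u_{s_3}$ for each $(s_1,s_2,s_3)\in\mathcal R$; and $R_S$ contains $\varepsilon_{s_2}\,\dot s_1\leadsto u_{s_1}$ for $(s_1:s_2)\in\mathcal A$ and $[A:u_{s_1},B:\varepsilon_{s_1}A\to u_{s_2}]\ \varepsilon_{s_3}(\dot\pi_{s_1s_2s_3}\,A\,B)\leadsto \Pi x:\varepsilon_{s_1}A.\,\varepsilon_{s_2}(B\,x)$ for $(s_1,s_2,s_3)\in\mathcal R$. Translation. For $\Gamma$-terms and $\Gamma$-types of $\lambda S$: $|s|_\Gamma=\dot s$, $|x|_\Gamma=x$, $|M\,N|_\Gamma=|M|_\Gamma\,|N|_\Gamma$, $|\lambda x:A.M|_\Gamma=\lambda x:\|A\|_\Gamma.\,|M|_{\Gamma,x:A}$, $|\Pi x:A.B|_\Gamma=\dot\pi_{s_1s_2s_3}\,|A|_\Gamma\,(\lambda x:\|A\|_\Gamma.\,|B|_{\Gamma,x:A})$ where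 $\Gamma\vdash A:s_1$, $\Gamma,x:A\vdash B:s_2$, $(s_1,s_2,s_3)\in\mathcal R$; $\|s\|_\Gamma=u_s$, $\|\Pi x:A.B\|_\Gamma=\Pi x:\|A\|_\Gamma.\,\|B\|_{\Gamma,x:A}$, and otherwise $\|A\|_\Gamma=\varepsilon_s\,|A|_\Gamma$ where $\Gamma\vdash A:s$ (well defined up to $\equiv_{\beta R}$). Contexts: $\|\cdot\|=\cdot$, $\|\Gamma,x:A\|=\|\Gamma\|,x:\|A\|_\Gamma$. *)

(* Defs.v *)
(* Pure type systems and the lambda-Pi calculus modulo rewriting,
   with de Bruijn indices (index 0 = most recently declared variable;
   contexts are lists whose head is the most recent declaration). *)
From Stdlib Require Import List Arith Relations.
Import ListNotations.

Inductive term (Srt C : Type) : Type :=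
| tSort : Srt -> term Srt C
| tVar : nat -> term Srt C
| tApp : term Srt C -> term Srt C -> term Srt C
| tLam : term Srt C -> term Srt C -> term Srt C
| tPi : term Srt C -> term Srt C -> term Srt C
| tConst : C -> term Srt C.
Arguments tSort {Srt C} s.
Arguments tVar {Srt C} n.
Arguments tApp {Srt C} M N.
Arguments tLam {Srt C} A M.
Arguments tPi {Srt C} A B.
Arguments tConst {Srt C} c.

Section Generic.
Context {Srt C : Type}.
Notation tm := (term Srt C).

Fixpoint lift (n k : nat) (t : tm) : tm :=
  match t with
  | tSort s => tSort s
  | tVar i => if Nat.leb k i then tVar (i + n) else tVar i
  | tApp M N => tApp (lift n k M) (lift n k N)
  | tLam A M => tLam (lift n k A) (lift n (Datatypes.S k) M)
  | tPi A B => tPi (lift n k A) (lift n (Datatypes.S k) B)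
  | tConst c => tConst c
  end.

Fixpoint subst (u : tm) (k : nat) (t : tm) : tm :=
  match t with
  | tSort s => tSort s
  | tVar i => match Nat.compare i k with
              | Lt => tVar i
              | Eq => lift k 0 u
              | Gt => tVar (pred i)
              end
  | tApp M N => tApp (subst u k M) (subst u k N)
  | tLam A M => tLam (subst u k A) (subst u (Datatypes.S k) M)
  | tPi A B => tPi (subst u k A) (subst u (Datatypes.S k) B)
  | tConst c => tConst c
  end.

Inductive ctx_clos (r : tm -> tm -> Prop) : tm -> tm -> Prop :=
| cc_top M N : r M N -> ctx_clos r M N
| cc_appl M M' N : ctx_clos r M M' -> ctx_clos r (tApp M N) (tApp M' N)
| cc_appr M N N' : ctx_clos r N N' -> ctx_clos r (tApp M N) (tApp M N')
| cc_laml A A' M : ctx_clos r A A' -> ctx_clos r (tLam A M) (tLam A' M)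
| cc_lamr A M M' : ctx_clos r M M' -> ctx_clos r (tLam A M) (tLam A M')
| cc_pil A A' B : ctx_clos r A A' -> ctx_clos r (tPi A B) (tPi A' B)
| cc_pir A B B' : ctx_clos r B B' -> ctx_clos r (tPi A B) (tPi A B').

Inductive beta_top : tm -> tm -> Prop :=
| beta_redex A M N : beta_top (tApp (tLam A M) N) (subst N 0 M).

Definition beta_step := ctx_clos beta_top.
Definition beta_conv := clos_refl_sym_trans tm beta_step.

Section Typing.
Variable ax : Srt -> Srt -> Prop.
Variable rl : Srt -> Srt -> Srt -> Prop.
Variable sig : C -> tm -> Prop.
Variable conv : tm -> tm -> Prop.

Inductive wf : list tm -> Prop :=
| wf_nil : wf []
| wf_cons G A s : typ G A (tSort s) -> wf (A :: G)
with typ : list tm -> tm -> tm -> Prop :=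
| ty_var G n A : wf G -> nth_error G n = Some A -> typ G (tVar n) (lift (S n) 0 A)
| ty_const G c A : wf G -> sig c A -> typ G (tConst c) A
| ty_sort G s1 s2 : wf G -> ax s1 s2 -> typ G (tSort s1) (tSort s2)
| ty_pi G A B s1 s2 s3 :
    typ G A (tSort s1) -> typ (A :: G) B (tSort s2) -> rl s1 s2 s3 ->
    typ G (tPi A B) (tSort s3)
| ty_lam G A M B s :
    typ (A :: G) M B -> typ G (tPi A B) (tSort s) -> typ G (tLam A M) (tPi A B)
| ty_app G M N A B :
    typ G M (tPi A B) -> typ G N A -> typ G (tApp M N) (subst N 0 B)
| ty_conv G M A B s :
    typ G M A -> typ G B (tSort s) -> conv A B -> typ G M B.
End Typing.
End Generic.

Definition functional {Srt : Type} (ax : Srt -> Srt -> Prop) (rl : Srt -> Srt -> Srt -> Prop) : Prop :=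
  (forall s1 s2 s2', ax s1 s2 -> ax s1 s2' -> s2 = s2') /\
  (forall s1 s2 s3 s3', rl s1 s2 s3 -> rl s1 s2 s3' -> s3 = s3').

Definition pterm (Srt : Type) := term Srt Empty_set.

Definition no_sig {Srt : Type} : Empty_set -> pterm Srt -> Prop := fun _ _ => False.

Definition wfS {Srt : Type} (ax : Srt -> Srt -> Prop) (rl : Srt -> Srt -> Srt -> Prop) :=
  @wf Srt Empty_set ax rl no_sig beta_conv.
Definition typS {Srt : Type} (ax : Srt -> Srt -> Prop) (rl : Srt -> Srt -> Srt -> Prop) :=
  @typ Srt Empty_set ax rl no_sig beta_conv.

Definition is_Gamma_type {Srt : Type} (ax : Srt -> Srt -> Prop) (rl : Srt -> Srt -> Srt -> Prop)
  (G : list (pterm Srt)) (A : pterm Srt) : Prop :=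
  wfS ax rl G /\ ((exists s, typS ax rl G A (tSort s)) \/ (exists s, A = tSort s)).

Inductive lpsort : Type := LType | LKind.

Inductive lp_ax : lpsort -> lpsort -> Prop :=
| lp_ax_type : lp_ax LType LKind.

Inductive lp_rl : lpsort -> lpsort -> lpsort -> Prop :=
| lp_rl_tt : lp_rl LType LType LType
| lp_rl_tk : lp_rl LType LKind LKind.

Inductive lpconst (Srt : Type) : Type :=
| cU : Srt -> lpconst Srt
| cEps : Srt -> lpconst Srt
| cDot : Srt -> lpconst Srt
| cPi : Srt -> Srt -> Srt -> lpconst Srt.
Arguments cU {Srt} s.
Arguments cEps {Srt} s.
Arguments cDot {Srt} s.
Arguments cPi {Srt} s1 s2 s3.

Definition lterm (Srt : Type) := term lpsort (lpconst Srt).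

Section LPS.
Context {Srt : Type}.
Variable ax : Srt -> Srt -> Prop.
Variable rl : Srt -> Srt -> Srt -> Prop.

Definition cst (c : lpconst Srt) : lterm Srt := tConst c.

Inductive sigS : lpconst Srt -> lterm Srt -> Prop :=
| sig_u s : sigS (cU s) (tSort LType)
| sig_eps s : sigS (cEps s) (tPi (cst (cU s)) (tSort LType))
| sig_dot s1 s2 : ax s1 s2 -> sigS (cDot s1) (cst (cU s2))
| sig_pi s1 s2 s3 : rl s1 s2 s3 ->
    sigS (cPi s1 s2 s3)
      (tPi (cst (cU s1))
           (tPi (tPi (tApp (cst (cEps s1)) (tVar 0)) (cst (cU s2)))
                (cst (cU s3)))).

Inductive RS_top : lterm Srt -> lterm Srt -> Prop :=
| rs_dot s1 s2 : ax s1 s2 ->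
    RS_top (tApp (cst (cEps s2)) (cst (cDot s1))) (cst (cU s1))
| rs_pi s1 s2 s3 A B : rl s1 s2 s3 ->
    RS_top (tApp (cst (cEps s3)) (tApp (tApp (cst (cPi s1 s2 s3)) A) B))
           (tPi (tApp (cst (cEps s1)) A)
                (tApp (cst (cEps s2)) (tApp (lift 1 0 B) (tVar 0)))).

Definition betaR_top (M N : lterm Srt) : Prop := beta_top M N \/ RS_top M N.
Definition betaR_step := ctx_clos betaR_top.
Definition betaR_conv := clos_refl_sym_trans (lterm Srt) betaR_step.

Definition wfLP := @wf lpsort (lpconst Srt) lp_ax lp_rl sigS betaR_conv.
Definition typLP := @typ lpsort (lpconst Srt) lp_ax lp_rl sigS betaR_conv.

(** * The translation |.|_Gamma (trans) and ||.||_Gamma (ttrans), as relations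
    (the paper's translation is defined up to the choice of sorts, i.e.
    well defined up to betaR-conversion). *)
Inductive trans : list (pterm Srt) -> pterm Srt -> lterm Srt -> Prop :=
| tr_sort G s : trans G (tSort s) (cst (cDot s))
| tr_var G n : trans G (tVar n) (tVar n)
| tr_app G M N M' N' :
    trans G M M' -> trans G N N' -> trans G (tApp M N) (tApp M' N')
| tr_lam G A M A' M' :
    ttrans G A A' -> trans (A :: G) M M' -> trans G (tLam A M) (tLam A' M')
| tr_pi G A B A1 A2 B' s1 s2 s3 :
    typS ax rl G A (tSort s1) -> typS ax rl (A :: G) B (tSort s2) -> rl s1 s2 s3 ->
    trans G A A1 -> ttrans G A A2 -> trans (A :: G) B B' ->
    trans G (tPi A B) (tApp (tApp (cst (cPi s1 s2 s3)) A1) (tLam A2 B'))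
with ttrans : list (pterm Srt) -> pterm Srt -> lterm Srt -> Prop :=
| tt_sort G s : ttrans G (tSort s) (cst (cU s))
| tt_pi G A B A' B' :
    ttrans G A A' -> ttrans (A :: G) B B' -> ttrans G (tPi A B) (tPi A' B')
| tt_el G A A' s :
    (forall s', A <> tSort s') -> (forall A1 B1, A <> tPi A1 B1) ->
    typS ax rl G A (tSort s) -> trans G A A' ->
    ttrans G A (tApp (cst (cEps s)) A').

Inductive ctrans : list (pterm Srt) -> list (lterm Srt) -> Prop :=
| ct_nil : ctrans [] []
| ct_cons G G' A A' : ctrans G G' -> ttrans G A A' -> ctrans (A :: G) (A' :: G').
End LPS.

(* Main.v *)
Require Import Defs.
From Stdlib Require Import List Arith Lia Relations Classical.
Import ListNotations.

(* Erase the lambda-Pi terms back to untyped PTS terms, reading [cEps s] as an identity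
   function and [cPi] as a product former: conversion modulo the rewrite rules becomes
   beta-conversion, and the erasure of a translated term is convertible to the original.
   The erasure of [N] need not be typable, because the lambda-Pi calculus has products which
   are not types of the PTS.  But [N] belongs to a Kripke logical relation over PTS contexts
   in which a type convertible to a PTS type [A] is interpreted by the terms convertible
   to an inhabitant of [A], and the other products are interpreted as function spaces.
   Which clause applies is recorded by a shape, computed from the lambda-Pi typing derivation
   alone and hence stable under substitution and under extension of the context.
   The two readings of a product cannot conflict, by uniqueness of types in functional PTSs. *)

(** * Simultaneous substitutions *)

Section Substitutions.
Context {Srt C : Type}.
Notation tm := (term Srt C).
Implicit Types (r s : nat -> tm) (x : nat -> nat) (t u : tm).

Definition up r (n : nat) : tm :=
  match n with 0 => tVar 0 | S n => lift 1 0 (r n) end.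

Fixpoint inst r (t : tm) : tm :=
  match t with
  | tSort s => tSort s
  | tVar n => r n
  | tApp M N => tApp (inst r M) (inst r N)
  | tLam A M => tLam (inst r A) (inst (up r) M)
  | tPi A B => tPi (inst r A) (inst (up r) B)
  | tConst c => tConst c
  end.

Definition scons (u : tm) r (n : nat) : tm :=
  match n with 0 => u | S n => r n end.

Definition ren x (n : nat) : tm := tVar (x n).
Definition shift (n i : nat) : tm := tVar (i + n).

Lemma up_ext r s : (forall n, r n = s n) -> forall n, up r n = up s n.
Proof. intros E [|n]; simpl; [easy|now rewrite E]. Qed.

Lemma inst_ext t : forall r s, (forall n, r n = s n) -> inst r t = inst s t.
Proof.
  induction t; intros r s' E; simpl; auto; f_equal; eauto using up_ext.
Qed.

Lemma lift_inst n t : forall k,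
  lift n k t = inst (ren (fun i => if k <=? i then i + n else i)) t.
Proof.
  assert (U : forall k i, ren (fun i => if S k <=? i then i + n else i) i
    = up (ren (fun i => if k <=? i then i + n else i)) i).
  { intros k [|i]; unfold ren; simpl; auto.
    destruct (k <=? i); simpl; f_equal; lia. }
  induction t; intros k; simpl; auto.
  - unfold ren. now destruct (k <=? n0).
  - now rewrite IHt1, IHt2.
  - rewrite IHt1, IHt2. f_equal. apply inst_ext, U.
  - rewrite IHt1, IHt2. f_equal. apply inst_ext, U.
Qed.

Lemma lift0_inst n t : lift n 0 t = inst (shift n) t.
Proof. rewrite lift_inst. now apply inst_ext. Qed.

Lemma inst_id t r : (forall n, r n = tVar n) -> inst r t = t.
Proof.
  revert r. induction t; intros r E; simpl; auto; f_equal; auto.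
  all: apply IHt2; intros [|n]; simpl; auto; now rewrite E; simpl; rewrite Nat.add_1_r.
Qed.

Lemma inst_ren_r t : forall r x, inst r (inst (ren x) t) = inst (fun n => r (x n)) t.
Proof.
  assert (E : forall x n, up (ren x) n =
    ren (fun n => match n with 0 => 0 | S n => S (x n) end) n).
  { intros x [|n]; unfold ren; simpl; auto. now rewrite Nat.add_1_r. }
  induction t; intros r x; simpl; auto; f_equal; auto.
  all: rewrite (inst_ext _ _ _ (E x)), IHt2; apply inst_ext; now intros [|n].
Qed.

Lemma inst_ren_l t : forall r x,
  inst (ren x) (inst r t) = inst (fun n => inst (ren x) (r n)) t.
Proof.
  assert (U : forall r x n, inst (up (ren x)) (up r n) = up (fun n => inst (ren x) (r n)) n).
  { intros r x [|n]; simpl; auto. rewrite !lift0_inst.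
    unfold shift. change (fun i => tVar (i + 1)) with (ren (fun i => i + 1)).
    rewrite !inst_ren_r.
    apply inst_ext. intros m. rewrite Nat.add_1_r. unfold ren. simpl.
    now rewrite Nat.add_1_r. }
  assert (E : forall x n, up (ren x) n =
    ren (fun n => match n with 0 => 0 | S n => S (x n) end) n).
  { intros x [|n]; unfold ren; simpl; auto. now rewrite Nat.add_1_r. }
  induction t; intros r x; simpl; auto; f_equal; auto.
  all: rewrite (inst_ext _ _ _ (E x)), IHt2; apply inst_ext;
    intros n; rewrite <- U; apply inst_ext; intros; symmetry; apply E.
Qed.

Lemma up_inst r s n : inst (up s) (up r n) = up (fun n => inst s (r n)) n.
Proof.
  destruct n; simpl; auto. rewrite !lift0_inst.
  unfold shift. change (fun i => tVar (i + 1)) with (ren (fun i => i + 1)).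
  rewrite inst_ren_r, inst_ren_l. apply inst_ext. intros m.
  rewrite Nat.add_1_r. simpl. now rewrite lift0_inst.
Qed.

Lemma inst_inst t : forall r s, inst s (inst r t) = inst (fun n => inst s (r n)) t.
Proof.
  induction t; intros r s'; simpl; auto; f_equal; auto.
  all: rewrite IHt2; apply inst_ext; intros; apply up_inst.
Qed.

Lemma lift_lift n m t : lift n 0 (lift m 0 t) = lift (n + m) 0 t.
Proof.
  rewrite !lift0_inst, inst_inst. apply inst_ext. intros i.
  unfold shift; simpl. f_equal; lia.
Qed.

Lemma lift_0 t : lift 0 0 t = t.
Proof. rewrite lift0_inst. apply inst_id. intros; unfold shift; f_equal; lia. Qed.

Lemma subst_inst u t : subst u 0 t = inst (scons u tVar) t.
Proof.
  enough (H : forall k, subst u k t = inst (fun i => match Nat.compare i k with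
      Lt => tVar i | Eq => lift k 0 u | Gt => tVar (pred i) end) t).
  { rewrite H. apply inst_ext. intros [|i]; simpl; auto using lift_0. }
  assert (U : forall k i, match Nat.compare i (S k) with
      Lt => tVar i | Eq => lift (S k) 0 u | Gt => tVar (pred i) end
    = up (fun i => match Nat.compare i k with
      Lt => tVar i | Eq => lift k 0 u | Gt => tVar (pred i) end) i).
  { intros k [|i]; simpl; auto.
    destruct (Nat.compare_spec i k); simpl; auto.
    - now rewrite lift_lift.
    - f_equal; lia.
    - f_equal; lia. }
  induction t; intros k; simpl; auto; f_equal; auto.
  all: rewrite IHt2; apply inst_ext, U.
Qed.

(** Closing a body under [up r] and then substituting is a single environment; this turns
    beta-contraction under an environment into an extension of that environment. *)
Lemma subst_up u r t : subst u 0 (inst (up r) t) = inst (scons u r) t.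
Proof.
  rewrite subst_inst, inst_inst. apply inst_ext. intros [|n]; simpl; auto.
  rewrite lift0_inst, inst_inst. apply inst_id. intros m. unfold shift. simpl.
  now rewrite Nat.add_1_r.
Qed.

Lemma inst_scons_inst u r s t :
  inst s (inst (scons u r) t) = inst (scons (inst s u) (fun n => inst s (r n))) t.
Proof. rewrite inst_inst. apply inst_ext. now intros [|n]. Qed.

Lemma inst_subst u r t : inst r (subst u 0 t) = subst (inst r u) 0 (inst (up r) t).
Proof.
  rewrite subst_up, subst_inst, inst_scons_inst. reflexivity.
Qed.

Lemma inst_scons_up u r s t :
  inst (scons u s) (inst (up r) t) = inst (scons u (fun n => inst s (r n))) t.
Proof.
  rewrite inst_inst. apply inst_ext. intros [|n]; simpl; auto.
  rewrite lift0_inst, inst_inst. apply inst_ext. intros m. unfold shift. simpl.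
  now rewrite Nat.add_1_r.
Qed.

Lemma inst_scons_shift u r t : inst (scons u r) (lift 1 0 t) = inst r t.
Proof.
  rewrite lift0_inst, inst_inst. apply inst_ext. intros m. unfold shift. simpl.
  now rewrite Nat.add_1_r.
Qed.

Lemma lift_S n t : lift (S n) 0 t = lift 1 0 (lift n 0 t).
Proof. now rewrite lift_lift. Qed.

Lemma up_lift r t : inst (up r) (lift 1 0 t) = lift 1 0 (inst r t).
Proof.
  rewrite !lift0_inst, !inst_inst. apply inst_ext. intros m. unfold shift. simpl.
  rewrite Nat.add_1_r. simpl. now rewrite lift0_inst.
Qed.

(** A Kripke clause evaluated at variable 0 of a one-step extension returns the open body itself, so
    a fresh variable serves as generic argument. *)
Lemma inst_var0_shift t : inst (scons (tVar 0) (shift 1)) t = t.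
Proof.
  apply inst_id. intros [|n]; simpl; auto. unfold shift. f_equal; lia.
Qed.

End Substitutions.

(** * Confluence of beta-reduction *)

Section Confluence.
Context {Srt C : Type}.
Notation tm := (term Srt C).
Notation red := (clos_refl_trans tm beta_step).
Implicit Types (M N P A B : tm) (r : nat -> tm).

Lemma red_map (f : tm -> tm) :
  (forall M N, beta_step M N -> beta_step (f M) (f N)) ->
  forall M N, red M N -> red (f M) (f N).
Proof.
  intros Hf M N H. induction H; [apply rt_step; auto|apply rt_refl|eapply rt_trans; eauto].
Qed.

Lemma red_app M M' N N' : red M M' -> red N N' -> red (tApp M N) (tApp M' N').
Proof.
  intros H1 H2. apply rt_trans with (tApp M' N).
  - apply (red_map (fun M => tApp M N)); auto. intros; now apply cc_appl.
  - apply (red_map (tApp M')); auto. intros; now apply cc_appr.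
Qed.

Lemma red_lam A A' M M' : red A A' -> red M M' -> red (tLam A M) (tLam A' M').
Proof.
  intros H1 H2. apply rt_trans with (tLam A' M).
  - apply (red_map (fun A => tLam A M)); auto. intros; now apply cc_laml.
  - apply (red_map (tLam A')); auto. intros; now apply cc_lamr.
Qed.

Lemma red_pi A A' M M' : red A A' -> red M M' -> red (tPi A M) (tPi A' M').
Proof.
  intros H1 H2. apply rt_trans with (tPi A' M).
  - apply (red_map (fun A => tPi A M)); auto. intros; now apply cc_pil.
  - apply (red_map (tPi A')); auto. intros; now apply cc_pir.
Qed.

(** Tait and Martin-Loef's parallel reduction: any set of redexes present in the term is contracted
    at once. *)
Inductive par : tm -> tm -> Prop :=
| par_sort s : par (tSort s) (tSort s)
| par_var n : par (tVar n) (tVar n)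
| par_const c : par (tConst c) (tConst c)
| par_app M M' N N' : par M M' -> par N N' -> par (tApp M N) (tApp M' N')
| par_lam A A' M M' : par A A' -> par M M' -> par (tLam A M) (tLam A' M')
| par_pi A A' B B' : par A A' -> par B B' -> par (tPi A B) (tPi A' B')
| par_beta A M M' N N' : par M M' -> par N N' ->
    par (tApp (tLam A M) N) (subst N' 0 M').

Lemma par_refl M : par M M.
Proof. induction M; constructor; auto. Qed.

Lemma par_step M N : beta_step M N -> par M N.
Proof.
  induction 1; try (constructor; auto using par_refl).
  destruct H. apply par_beta; apply par_refl.
Qed.

Lemma par_red M N : par M N -> red M N.
Proof.
  induction 1; auto using rt_refl, red_app, red_lam, red_pi.
  apply rt_trans with (tApp (tLam A M') N').
  - apply red_app; auto. apply red_lam; auto using rt_refl.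
  - apply rt_step, cc_top, beta_redex.
Qed.

Lemma par_ren M N x : par M N -> par (inst (ren x) M) (inst (ren x) N).
Proof.
  intros H. revert x.
  assert (E : forall x (t : tm), inst (up (ren x)) t =
    inst (ren (fun n => match n with 0 => 0 | S n => S (x n) end)) t).
  { intros x t. apply inst_ext. intros [|n]; unfold ren; simpl; auto.
    now rewrite Nat.add_1_r. }
  induction H; intros x; simpl; try (constructor; auto); rewrite ?E; auto.
  rewrite inst_subst, E. apply par_beta; auto.
Qed.

Lemma par_inst M N : par M N ->
  forall r s, (forall n, par (r n) (s n)) -> par (inst r M) (inst s N).
Proof.
  assert (U : forall r s : nat -> tm, (forall n, par (r n) (s n)) ->
    forall n, par (up r n) (up s n)).
  { intros r s H [|n]; simpl; [constructor|]. rewrite !lift0_inst.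
    apply (par_ren _ _ (fun i => i + 1)), H. }
  induction 1; intros r s' Hr; simpl; auto; try (constructor; auto).
  rewrite inst_subst. apply par_beta; auto.
Qed.

Lemma par_subst M M' N N' : par M M' -> par N N' -> par (subst N 0 M) (subst N' 0 M').
Proof.
  intros. rewrite !subst_inst. apply par_inst; auto.
  intros [|n]; simpl; auto using par_refl.
Qed.

Fixpoint dev (t : tm) : tm :=
  match t with
  | tSort s => tSort s
  | tVar n => tVar n
  | tConst c => tConst c
  | tApp (tLam A M) N => subst (dev N) 0 (dev M)
  | tApp M N => tApp (dev M) (dev N)
  | tLam A M => tLam (dev A) (dev M)
  | tPi A B => tPi (dev A) (dev B)
  end.

(** Takahashi's triangle property: a parallel step contracts some of the redexes of [M], and
    contracting the remaining ones leads to the complete development [dev M], whichever step was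
    taken. *)
Lemma par_dev M N : par M N -> par N (dev M).
Proof.
  induction 1; simpl; try (constructor; auto); auto using par_subst.
  destruct M; try (constructor; auto; fail).
  simpl in IHpar1. inversion H; subst. inversion IHpar1; subst.
  now apply par_beta.
Qed.

Lemma par_red_confluent M N : par M N -> forall P, red M P -> exists Q, red N Q /\ par P Q.
Proof.
  intros H P HP. revert N H. apply clos_rt_rt1n in HP.
  induction HP; intros N HN.
  - exists N. split; auto using rt_refl.
  - apply par_step in H.
    destruct (IHHP (dev x) (par_dev _ _ H)) as (Q & H1 & H2).
    exists Q. split; auto. eapply rt_trans; [apply par_red, par_dev, HN|auto].
Qed.

Lemma red_confluent M N P : red M N -> red M P -> exists Q, red N Q /\ red P Q.
Proof.
  intros H. revert P. apply clos_rt_rt1n in H. induction H; intros P HP.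
  - exists P. split; auto using rt_refl.
  - destruct (par_red_confluent _ _ (par_step _ _ H) _ HP) as (Q & H1 & H2).
    destruct (IHclos_refl_trans_1n _ H1) as (Q' & H3 & H4).
    exists Q'. split; auto. eapply rt_trans; [apply par_red; eauto|auto].
Qed.

Lemma conv_join (M N : tm) : beta_conv M N -> exists Q, red M Q /\ red N Q.
Proof.
  induction 1.
  - exists y. split; auto using rt_step, rt_refl.
  - exists x. split; apply rt_refl.
  - destruct IHclos_refl_sym_trans as (Q & ? & ?). eauto.
  - destruct IHclos_refl_sym_trans1 as (Q1 & ? & ?).
    destruct IHclos_refl_sym_trans2 as (Q2 & ? & ?).
    destruct (red_confluent _ _ _ H2 H3) as (Q & ? & ?).
    exists Q. split; eapply rt_trans; eauto.
Qed.

(** * Consequences of confluence: congruence, normal forms, injectivity of products *)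

Lemma red_conv (M N : tm) : red M N -> beta_conv M N.
Proof. apply clos_rt_clos_rst. Qed.

Lemma conv_refl (M : tm) : beta_conv M M.
Proof. apply rst_refl. Qed.

Lemma conv_sym (M N : tm) : beta_conv M N -> beta_conv N M.
Proof. apply rst_sym. Qed.

Lemma conv_trans (M N P : tm) : beta_conv M N -> beta_conv N P -> beta_conv M P.
Proof. apply rst_trans. Qed.

Lemma conv_app (M M' N N' : tm) :
  beta_conv M M' -> beta_conv N N' -> beta_conv (tApp M N) (tApp M' N').
Proof.
  intros H1 H2. destruct (conv_join _ _ H1) as (? & ? & ?), (conv_join _ _ H2) as (? & ? & ?).
  eapply conv_trans; [|apply conv_sym]; apply red_conv, red_app; eauto.
Qed.

Lemma conv_lam (M M' N N' : tm) :
  beta_conv M M' -> beta_conv N N' -> beta_conv (tLam M N) (tLam M' N').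
Proof.
  intros H1 H2. destruct (conv_join _ _ H1) as (? & ? & ?), (conv_join _ _ H2) as (? & ? & ?).
  eapply conv_trans; [|apply conv_sym]; apply red_conv, red_lam; eauto.
Qed.

Lemma conv_pi (M M' N N' : tm) :
  beta_conv M M' -> beta_conv N N' -> beta_conv (tPi M N) (tPi M' N').
Proof.
  intros H1 H2. destruct (conv_join _ _ H1) as (? & ? & ?), (conv_join _ _ H2) as (? & ? & ?).
  eapply conv_trans; [|apply conv_sym]; apply red_conv, red_pi; eauto.
Qed.

Lemma conv_beta (A M N : tm) : beta_conv (tApp (tLam A M) N) (subst N 0 M).
Proof. apply rst_step, cc_top, beta_redex. Qed.

Lemma red_inst M N : red M N -> forall r, red (inst r M) (inst r N).
Proof.
  induction 1; intros r; [|apply rt_refl|eapply rt_trans; eauto].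
  apply par_red, par_inst; auto using par_step, par_refl.
Qed.

Lemma conv_inst (M N : tm) r : beta_conv M N -> beta_conv (inst r M) (inst r N).
Proof.
  intros H. destruct (conv_join _ _ H) as (Q & ? & ?).
  eapply conv_trans; [|apply conv_sym]; apply red_conv, red_inst; eauto.
Qed.

Lemma conv_lift (M N : tm) n : beta_conv M N -> beta_conv (lift n 0 M) (lift n 0 N).
Proof. rewrite !lift0_inst. apply conv_inst. Qed.

Lemma inst_env_conv (M : tm) : forall r s, (forall n, beta_conv (r n) (s n)) ->
  beta_conv (inst r M) (inst s M).
Proof.
  assert (U : forall r s : nat -> tm, (forall n, beta_conv (r n) (s n)) ->
    forall n, beta_conv (up r n) (up s n)).
  { intros r s H [|n]; simpl; auto using conv_refl, conv_lift. }
  induction M; intros r s' H; simpl; auto using conv_refl, conv_app, conv_lam, conv_pi.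
Qed.

Lemma conv_scons (M M' N N' : tm) r : beta_conv M M' -> beta_conv N N' ->
  beta_conv (inst (scons N r) M) (inst (scons N' r) M').
Proof.
  intros H1 H2. eapply conv_trans; [apply conv_inst, H1|].
  apply inst_env_conv. intros [|n]; simpl; auto using conv_refl.
Qed.

Lemma red_pi_inv A B M : red (tPi A B) M ->
  exists A' B', M = tPi A' B' /\ red A A' /\ red B B'.
Proof.
  intros H. remember (tPi A B) as P eqn:E. revert A B E. apply clos_rt_rt1n in H.
  induction H; intros A B E; subst.
  - exists A, B. auto using rt_refl.
  - inversion H; subst; [now inversion H1| |];
      destruct (IHclos_refl_trans_1n _ _ eq_refl) as (A1 & B1 & ? & ? & ?);
      exists A1, B1; repeat split; auto; eapply rt_trans; eauto; now apply rt_step.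
Qed.

Definition normal (M : tm) := forall N, ~ beta_step M N.

Lemma red_normal M N : normal M -> red M N -> N = M.
Proof.
  intros H1 H2. apply clos_rt_rt1n in H2. destruct H2; auto. now apply H1 in H.
Qed.

Lemma conv_normal M N : normal N -> beta_conv M N -> red M N.
Proof.
  intros H1 H2. destruct (conv_join _ _ H2) as (Q & H3 & H4).
  apply red_normal in H4; auto. now subst.
Qed.

Lemma conv_normal_eq (M N : tm) : normal M -> normal N -> beta_conv M N -> M = N.
Proof.
  intros H1 H2 H3. symmetry. apply red_normal; auto. now apply conv_normal.
Qed.

Lemma conv_normal_pi A B N : normal N -> beta_conv (tPi A B) N ->
  exists A' B', N = tPi A' B'.
Proof.
  intros H1 H2. apply conv_normal in H2; auto.
  destruct (red_pi_inv _ _ _ H2) as (A' & B' & ? & ?). eauto.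
Qed.

Lemma normal_sort s : normal (tSort s).
Proof. intros N H. inversion H; subst. inversion H0. Qed.

Lemma conv_sort_inj s s' : beta_conv (tSort s : tm) (tSort s') -> s = s'.
Proof. intros H. apply conv_normal_eq in H; auto using normal_sort. congruence. Qed.

(** A product reduces only to products, so the common reduct provided by confluence is one. *)
Lemma conv_pi_red M A B : beta_conv M (tPi A B) ->
  exists A' B', red M (tPi A' B') /\ beta_conv A A' /\ beta_conv B B'.
Proof.
  intros H. destruct (conv_join _ _ H) as (Q & H1 & H2).
  destruct (red_pi_inv _ _ _ H2) as (A' & B' & -> & ? & ?).
  exists A', B'. auto using red_conv.
Qed.

Lemma conv_pi_inj A B A' B' : beta_conv (tPi A B) (tPi A' B') ->
  beta_conv A A' /\ beta_conv B B'.
Proof.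
  intros H. destruct (conv_pi_red _ _ _ H) as (A1 & B1 & H1 & ? & ?).
  destruct (red_pi_inv _ _ _ H1) as (A2 & B2 & E & ? & ?). inversion E; subst.
  split; eapply conv_trans; try (apply red_conv; eassumption); now apply conv_sym.
Qed.

Lemma conv_pi_sort A B s : ~ beta_conv (tPi A B) (tSort s).
Proof.
  intros H. apply conv_normal_pi in H; auto using normal_sort.
  destruct H as (? & ? & ?); discriminate.
Qed.

End Confluence.
Notation red := (clos_refl_trans _ beta_step).
(** * Typing with explicit domain and codomain premises *)

Section Annotated.
Context {Srt C : Type}.
Notation tm := (term Srt C).
Variable ax : Srt -> Srt -> Prop.
Variable rl : Srt -> Srt -> Srt -> Prop.
Variable sig : C -> tm -> Prop.
Variable conv : tm -> tm -> Prop.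

(* Well-formedness of the context is not a premise, and abstraction and application record
   the typing of the product.  So a derivation contains derivations for the types on which
   an induction has to rely, and substitution and subject reduction hold in arbitrary
   contexts. *)
Inductive atyp : list tm -> tm -> tm -> Prop :=
| at_var G n A : nth_error G n = Some A -> atyp G (tVar n) (lift (S n) 0 A)
| at_const G c A : sig c A -> atyp G (tConst c) A
| at_sort G s1 s2 : ax s1 s2 -> atyp G (tSort s1) (tSort s2)
| at_pi G A B s1 s2 s3 :
    atyp G A (tSort s1) -> atyp (A :: G) B (tSort s2) -> rl s1 s2 s3 ->
    atyp G (tPi A B) (tSort s3)
| at_lam G A M B s1 s2 s3 :
    atyp G A (tSort s1) -> atyp (A :: G) B (tSort s2) -> rl s1 s2 s3 ->
    atyp (A :: G) M B -> atyp G (tLam A M) (tPi A B)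
| at_app G M N A B s1 s2 s3 :
    atyp G A (tSort s1) -> atyp (A :: G) B (tSort s2) -> rl s1 s2 s3 ->
    atyp G M (tPi A B) -> atyp G N A -> atyp G (tApp M N) (subst N 0 B)
| at_conv G M A B s :
    atyp G M A -> atyp G B (tSort s) -> conv A B -> atyp G M B.

Inductive awf : list tm -> Prop :=
| awf_nil : awf []
| awf_cons G A s : awf G -> atyp G A (tSort s) -> awf (A :: G).

Hypothesis conv_stable : forall A B r, conv A B -> conv (inst r A) (inst r B).
Hypothesis sig_closed : forall c A r, sig c A -> inst r A = A.
Hypothesis sig_typed : forall c A, sig c A ->
  (exists s, A = tSort s) \/ exists s, atyp [] A (tSort s).

(** Renamings come before general environments, since pushing an environment under a binder in
    [atyp_inst] requires weakening. *)
Lemma atyp_ren G M A : atyp G M A -> forall G' x,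
  (forall n B, nth_error G n = Some B -> exists B', nth_error G' (x n) = Some B' /\
     lift (S (x n)) 0 B' = inst (ren x) (lift (S n) 0 B)) ->
  atyp G' (inst (ren x) M) (inst (ren x) A).
Proof.
  assert (E : forall x (t : tm), inst (up (ren x)) t =
    inst (ren (fun n => match n with 0 => 0 | S n => S (x n) end)) t).
  { intros x t. apply inst_ext. intros [|n]; unfold ren; simpl; auto.
    now rewrite Nat.add_1_r. }
  assert (U : forall (G G' : list tm) x A,
    (forall n B, nth_error G n = Some B -> exists B', nth_error G' (x n) = Some B' /\
       lift (S (x n)) 0 B' = inst (ren x) (lift (S n) 0 B)) ->
    forall n B, nth_error (A :: G) n = Some B -> exists B',
      nth_error (inst (ren x) A :: G') (match n with 0 => 0 | S n => S (x n) end) = Some B' /\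
      lift (S (match n with 0 => 0 | S n => S (x n) end)) 0 B' =
      inst (ren (fun n => match n with 0 => 0 | S n => S (x n) end)) (lift (S n) 0 B)).
  { intros G0 G' x A0 H [|n] B HB; simpl in *.
    - injection HB as <-. eexists. split; [reflexivity|]. now rewrite <- E, up_lift.
    - destruct (H _ _ HB) as (B' & ? & HB'). exists B'. split; auto.
      rewrite lift_S, HB', (lift_S (S n)), <- E, up_lift. reflexivity. }
  induction 1; intros G' x Hx; simpl.
  - destruct (Hx _ _ H) as (B' & HB & <-). now apply at_var.
  - rewrite (sig_closed _ _ _ H). now apply at_const.
  - now apply at_sort.
  - rewrite E. eapply at_pi; eauto.
  - rewrite !E. eapply at_lam; eauto.
  - rewrite inst_subst, E. eapply at_app; eauto.
    rewrite <- E. now apply IHatyp3.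
  - eapply at_conv; eauto.
Qed.

Lemma atyp_weaken D G M A : atyp G M A ->
  atyp (D ++ G) (lift (length D) 0 M) (lift (length D) 0 A).
Proof.
  intros H. rewrite !lift0_inst. apply (atyp_ren _ _ _ H (D ++ G) (fun i => i + length D)).
  intros n B HB. exists B. split.
  - rewrite nth_error_app2 by lia. now replace (n + length D - length D) with n by lia.
  - rewrite lift_inst. rewrite !lift0_inst, inst_inst. apply inst_ext. intros m.
    unfold shift, ren. simpl. f_equal; lia.
Qed.

Lemma atyp_weaken1 E G M A : atyp G M A -> atyp (E :: G) (lift 1 0 M) (lift 1 0 A).
Proof. apply (atyp_weaken [E]). Qed.

Lemma atyp_inst G M A : atyp G M A -> forall G' r,
  (forall n B, nth_error G n = Some B -> atyp G' (r n) (inst r (lift (S n) 0 B))) ->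
  atyp G' (inst r M) (inst r A).
Proof.
  assert (U : forall (G G' : list tm) r A,
    (forall n B, nth_error G n = Some B -> atyp G' (r n) (inst r (lift (S n) 0 B))) ->
    forall n B, nth_error (A :: G) n = Some B ->
      atyp (inst r A :: G') (up r n) (inst (up r) (lift (S n) 0 B))).
  { intros G0 G' r A0 H [|n] B HB; simpl in *.
    - injection HB as <-. rewrite up_lift. now apply at_var.
    - rewrite (lift_S (S n)), up_lift. now apply atyp_weaken1, H. }
  induction 1; intros G' r Hr; simpl.
  - auto.
  - rewrite (sig_closed _ _ _ H). now apply at_const.
  - now apply at_sort.
  - eapply at_pi; eauto.
  - eapply at_lam; eauto.
  - rewrite inst_subst. eapply at_app; eauto.
  - eapply at_conv; eauto.
Qed.

Lemma atyp_var0 G A : atyp (A :: G) (tVar 0) (lift 1 0 A).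
Proof. now apply at_var. Qed.

Lemma atyp_subst G A M B N : atyp (A :: G) M B -> atyp G N A ->
  atyp G (subst N 0 M) (subst N 0 B).
Proof.
  intros HM HN. rewrite !subst_inst. eapply atyp_inst; eauto.
  intros [|n] B' HB; simpl in HB.
  - injection HB as <-. rewrite inst_scons_shift, inst_id; auto.
  - rewrite lift_S, inst_scons_shift, inst_id; auto. now apply at_var.
Qed.

Lemma atyp_pi_inv G A B T : atyp G (tPi A B) T -> exists s1 s2 s3,
  atyp G A (tSort s1) /\ atyp (A :: G) B (tSort s2) /\ rl s1 s2 s3.
Proof.
  intros H. remember (tPi A B) as P eqn:EP. revert A B EP.
  induction H; intros A0 B0 EP; try discriminate; eauto.
  injection EP as -> ->. eauto 8.
Qed.

(** The premises recorded for abstraction and application type the product and its codomain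
    directly; well-formedness of [G] types the types of the variables. *)
Lemma atyp_correct G M T : awf G -> atyp G M T ->
  (exists s, T = tSort s) \/ exists s, atyp G T (tSort s).
Proof.
  intros HG H. induction H; eauto.
  - right. revert n H. induction HG as [|G B s HG IH HB]; intros [|n] H; try discriminate.
    + injection H as <-. exists s. now apply (atyp_weaken1 B) in HB.
    + destruct (IH _ H) as [s' Hs]. exists s'. rewrite lift_S.
      now apply (atyp_weaken1 B) in Hs.
  - destruct (sig_typed _ _ H) as [?|[s Hs]]; auto. right. exists s.
    apply (atyp_weaken G) in Hs. rewrite app_nil_r, !lift0_inst in Hs.
    now rewrite (sig_closed _ _ _ H) in Hs.
  - right. eexists. eapply at_pi; eauto.
  - right. exists s2. now apply (atyp_subst _ _ _ _ _ H0).
Qed.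

Scheme typ_min := Minimality for typ Sort Prop
  with wf_min := Minimality for wf Sort Prop.
Combined Scheme typ_wf_min from typ_min, wf_min.

(** The premises added in [atyp] are recovered by inverting a typing of the product. For an
    abstraction it is a premise; for an application it comes from correctness of types, a product
    not being a sort. *)
Lemma typ_wf_atyp :
  (forall G M A, typ ax rl sig conv G M A -> awf G /\ atyp G M A) /\
  (forall G, wf ax rl sig conv G -> awf G).
Proof.
  apply typ_wf_min; intros.
  - split; auto. now apply at_var.
  - split; auto. now apply at_const.
  - split; auto. now apply at_sort.
  - destruct H0, H2. split; auto. eapply at_pi; eauto.
  - destruct H0, H2. split; auto. destruct (atyp_pi_inv _ _ _ _ H4) as (? & ? & ? & ? & ? & ?).
    eapply at_lam; eauto.
  - destruct H0, H2. split; auto.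
    destruct (atyp_correct _ _ _ H0 H3) as [[? ?]|[? HP]]; [discriminate|].
    destruct (atyp_pi_inv _ _ _ _ HP) as (? & ? & ? & ? & ? & ?).
    eapply at_app; eauto.
  - destruct H0, H2. split; auto. eapply at_conv; eauto.
  - constructor.
  - destruct H0. econstructor; eauto.
Qed.

Lemma atyp_typ G M A : atyp G M A -> wf ax rl sig conv G -> typ ax rl sig conv G M A.
Proof.
  induction 1; intros HG.
  - now apply ty_var.
  - now apply ty_const.
  - now apply ty_sort.
  - eapply ty_pi; eauto. apply IHatyp2. econstructor; eauto.
  - assert (wf ax rl sig conv (A :: G)) by (econstructor; eauto).
    eapply ty_lam; eauto. eapply ty_pi; eauto.
  - eapply ty_app; eauto.
  - eapply ty_conv; eauto.
Qed.

End Annotated.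

(** * Subject reduction and uniqueness of types *)

Section PTS.
Context {Srt : Type}.
Variable ax : Srt -> Srt -> Prop.
Variable rl : Srt -> Srt -> Srt -> Prop.
Hypothesis fun_spec : functional ax rl.
Notation tm := (pterm Srt).
Notation atypS := (atyp ax rl no_sig (@beta_conv Srt Empty_set)).

Lemma no_sig_closed (c : Empty_set) (A : tm) r : no_sig c A -> inst r A = A.
Proof. contradiction. Qed.

Notation weaken1 := (atyp_weaken1 _ _ _ _ conv_inst no_sig_closed).
Notation subst_typ := (atyp_subst _ _ _ _ conv_inst no_sig_closed).

(** Generation: a derivation ends with the rule of the head constructor followed by conversions, so
    the type is convertible to the one which that rule gives. The next lemmas say the same for the
    other constructors. *)
Lemma gen_sort G s T : atypS G (tSort s) T -> exists s', ax s s' /\ beta_conv (tSort s') T.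
Proof.
  intros H. remember (tSort s) as P eqn:EP. induction H; try discriminate.
  - injection EP as ->. exists s2. auto using conv_refl.
  - destruct (IHatyp1 EP) as (s' & ? & ?). exists s'. eauto using conv_trans.
Qed.

Lemma gen_var G n T : atypS G (tVar n) T ->
  exists A, nth_error G n = Some A /\ beta_conv (lift (S n) 0 A) T.
Proof.
  intros H. remember (tVar n) as P eqn:EP. induction H; try discriminate.
  - injection EP as ->. exists A. auto using conv_refl.
  - destruct (IHatyp1 EP) as (s' & ? & ?). exists s'. eauto using conv_trans.
Qed.

Lemma gen_pi G A B T : atypS G (tPi A B) T -> exists s1 s2 s3,
  atypS G A (tSort s1) /\ atypS (A :: G) B (tSort s2) /\ rl s1 s2 s3 /\
  beta_conv (tSort s3) T.
Proof.
  intros H. remember (tPi A B) as P eqn:EP. induction H; try discriminate.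
  - injection EP as -> ->. exists s1, s2, s3. auto using conv_refl.
  - destruct (IHatyp1 EP) as (s1 & s2 & s3 & ? & ? & ? & ?).
    exists s1, s2, s3. eauto using conv_trans.
Qed.

Lemma gen_lam G A M T : atypS G (tLam A M) T -> exists B s1 s2 s3,
  atypS G A (tSort s1) /\ atypS (A :: G) B (tSort s2) /\ rl s1 s2 s3 /\
  atypS (A :: G) M B /\ beta_conv (tPi A B) T.
Proof.
  intros H. remember (tLam A M) as P eqn:EP. induction H; try discriminate.
  - injection EP as -> ->. exists B, s1, s2, s3. auto using conv_refl.
  - destruct (IHatyp1 EP) as (B' & s1 & s2 & s3 & ? & ? & ? & ? & ?).
    exists B', s1, s2, s3. eauto 6 using conv_trans.
Qed.

Lemma gen_app G M N T : atypS G (tApp M N) T -> exists A B,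
  atypS G M (tPi A B) /\ atypS G N A /\ beta_conv (subst N 0 B) T.
Proof.
  intros H. remember (tApp M N) as P eqn:EP. induction H; try discriminate.
  - injection EP as -> ->. exists A, B. auto using conv_refl.
  - destruct (IHatyp1 EP) as (A' & B' & ? & ? & ?).
    exists A', B'. eauto using conv_trans.
Qed.

(** Functionality of the axioms settles sorts and functionality of the rules settles products; the
    other cases follow by generation, with product injectivity for applications. *)
Lemma atyp_unique G M A : atypS G M A -> forall A', atypS G M A' -> beta_conv A A'.
Proof.
  induction 1; intros T HT.
  - destruct (gen_var _ _ _ HT) as (A' & E & ?). congruence.
  - destruct c.
  - destruct (gen_sort _ _ _ HT) as (s' & H1 & ?).
    now rewrite (proj1 fun_spec _ _ _ H H1).
  - destruct (gen_pi _ _ _ _ HT) as (s1' & s2' & s3' & H2 & H3 & H4 & H5).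
    rewrite <- (conv_sort_inj _ _ (IHatyp1 _ H2)), <- (conv_sort_inj _ _ (IHatyp2 _ H3)) in H4.
    now rewrite (proj2 fun_spec _ _ _ _ H1 H4).
  - destruct (gen_lam _ _ _ _ HT) as (B' & ? & ? & ? & ? & ? & ? & H8 & H9).
    eapply conv_trans; [|apply H9]. apply conv_pi; auto using conv_refl.
  - destruct (gen_app _ _ _ _ HT) as (A' & B' & H4 & ? & H6).
    eapply conv_trans; [|apply H6].
    destruct (conv_pi_inj _ _ _ _ (IHatyp3 _ H4)) as [_ ?].
    rewrite !subst_inst. now apply conv_inst.
  - eapply conv_trans; [apply conv_sym; eauto|auto].
Qed.

(** The identity is a well-typed environment from [A :: G] into [A' :: G]: the head variable has
    type [A'] and is converted back to [A]. *)
Lemma atyp_ctx_conv G A A' s M B : beta_conv A A' -> atypS G A (tSort s) ->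
  atypS (A :: G) M B -> atypS (A' :: G) M B.
Proof.
  intros H1 H2 H3.
  rewrite <- (inst_id M tVar), <- (inst_id B tVar) by auto.
  eapply atyp_inst; eauto using conv_inst, no_sig_closed.
  intros [|n] B' HB; simpl in HB; rewrite inst_id by auto.
  - injection HB as <-. eapply at_conv; [apply atyp_var0|apply (weaken1 _ _ _ _ H2)|].
    now apply conv_lift, conv_sym.
  - now apply at_var.
Qed.

Lemma beta_step_conv (M N : tm) : beta_step M N -> beta_conv M N.
Proof. apply rst_step. Qed.

Lemma atyp_step G M A : atypS G M A -> forall M', beta_step M M' -> atypS G M' A.
Proof.
  induction 1; intros M' HM.
  - inversion HM; subst. inversion H0.
  - destruct c.
  - now apply normal_sort in HM.
  - inversion HM; subst; [now inversion H2| |].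
    + apply at_pi with s1 s2; auto.
      eapply atyp_ctx_conv; eauto using beta_step_conv.
    + apply at_pi with s1 s2; auto.
  - inversion HM; subst; [now inversion H3| |].
    + apply at_conv with (tPi A' B) s3.
      * apply at_lam with s1 s2 s3; auto; eapply atyp_ctx_conv; eauto using beta_step_conv.
      * eapply at_pi; eauto.
      * apply conv_sym, conv_pi; auto using beta_step_conv, conv_refl.
    + eapply at_lam; eauto.
  - inversion HM; subst.
    + inversion H4; subst.
      (* The product inferred for the abstraction is convertible to the one recorded in the
         application; injectivity transports the argument in one direction and the result in the
         other. *)
      destruct (gen_lam _ _ _ _ H2) as (B' & s1' & s2' & s3' & ? & ? & ? & ? & HP).
      destruct (conv_pi_inj _ _ _ _ HP) as [HA HB].
      assert (atypS G N A0) by (eapply at_conv; eauto using conv_sym).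
      apply at_conv with (subst N 0 B') s2.
      * eapply subst_typ; eauto.
      * apply (subst_typ _ _ _ _ _ H0 H3).
      * rewrite !subst_inst. now apply conv_inst.
    + eapply at_app; eauto.
    + apply at_conv with (subst N' 0 B) s2.
      * eapply at_app; eauto.
      * apply (subst_typ _ _ _ _ _ H0 H3).
      * rewrite !subst_inst. apply conv_scons; auto using conv_refl.
        now apply conv_sym, beta_step_conv.
  - eapply at_conv; eauto.
Qed.

Lemma atyp_red G M A M' : atypS G M A -> red M M' -> atypS G M' A.
Proof.
  intros H1 H2. apply clos_rt_rt1n in H2. induction H2; auto.
  apply IHclos_refl_trans_1n. eapply atyp_step; eauto.
Qed.

(** By subject reduction the common reduct has both types. Hence a type cannot have two different
    shapes [skEl]. *)
Lemma atyp_unique_conv G M M' s s' : atypS G M (tSort s) -> atypS G M' (tSort s') ->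
  beta_conv M M' -> s = s'.
Proof.
  intros H1 H2 H3. destruct (conv_join _ _ H3) as (Q & ? & ?).
  apply (@conv_sort_inj _ Empty_set).
  eapply atyp_unique; eapply atyp_red; eauto.
Qed.

(** The components [P1] and [P2] may come from an erasure and need not be typable; a reduct of [A]
    supplies typed components convertible to them. *)
Lemma atyp_conv_pi G A P1 P2 s : atypS G A (tSort s) -> beta_conv A (tPi P1 P2) ->
  exists A1 A2 s1 s2, beta_conv P1 A1 /\ beta_conv P2 A2 /\ beta_conv A (tPi A1 A2) /\
    atypS G (tPi A1 A2) (tSort s) /\
    atypS G A1 (tSort s1) /\ atypS (A1 :: G) A2 (tSort s2) /\ rl s1 s2 s.
Proof.
  intros HA H. destruct (conv_pi_red _ _ _ H) as (A1 & A2 & HR & ? & ?).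
  assert (HP : atypS G (tPi A1 A2) (tSort s)) by (eapply atyp_red; eauto).
  destruct (gen_pi _ _ _ _ HP) as (s1 & s2 & s3 & ? & ? & ? & E).
  apply conv_sort_inj in E as ->.
  exists A1, A2, s1, s2. auto 8 using red_conv.
Qed.

Lemma atyp_conv_normal G A s N : atypS G A (tSort s) -> beta_conv A N -> normal N ->
  atypS G N (tSort s).
Proof. intros H1 H2 H3. eapply atyp_red; eauto. now apply conv_normal. Qed.
(** * The reducibility predicates *)

(** [skEl s] is the shape of the PTS types of sort [s], [skTop s] that of a sort [s] which has no
    type itself, [skArr] that of a function space, and [skSort l a] that of the lambda-Pi sort [l]
    when its elements are types of shape [a]. *)
Inductive skel : Type :=
| skEl (s : Srt)
| skTop (s : Srt)
| skArr (a b : skel)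
| skSort (l : lpsort) (a : skel).

Variable s0 : Srt.

(* Closed normal untypable terms standing for the two sorts of the lambda-Pi calculus. *)
Definition mark (l : lpsort) : tm :=
  match l with
  | LType => tApp (tSort s0) (tSort s0)
  | LKind => tApp (tApp (tSort s0) (tSort s0)) (tSort s0)
  end.

Notation "M == N" := (beta_conv M N) (at level 70).
Notation inst1 N n := (inst (scons N (shift n))).

(* [fst (sem a) G P] says that [P] is a valid type of shape [a] in [G], and
   [snd (sem a) G P M] that [M] is a reducible element of it.  A product which is a type
   of the PTS has shape [skEl s], and its elements are the terms convertible to typed terms;
   only the products which are not types of the PTS are interpreted as function spaces.
   The elements of a sort [l] of shape [skSort l a] are the valid types of shape [a]. *)
Fixpoint sem (a : skel) : (list tm -> tm -> Prop) * (list tm -> tm -> tm -> Prop) :=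
  match a with
  | skEl s =>
      (fun G P => exists A, P == A /\ atypS G A (tSort s),
       fun G P M => exists A M', P == A /\ M == M' /\ atypS G A (tSort s) /\ atypS G M' A)
  | skTop s =>
      (fun G P => P == tSort s /\ forall s', ~ ax s s',
       fun G P M => exists M', M == M' /\ atypS G M' (tSort s))
  | skArr a b =>
      (fun G P => exists P1 P2, P == tPi P1 P2 /\ fst (sem a) G P1 /\
         forall D N, snd (sem a) (D ++ G) (lift (length D) 0 P1) N ->
           fst (sem b) (D ++ G) (inst1 N (length D) P2),
       fun G P M => exists P1 P2, P == tPi P1 P2 /\
         forall D N, snd (sem a) (D ++ G) (lift (length D) 0 P1) N ->
           snd (sem b) (D ++ G) (inst1 N (length D) P2) (tApp (lift (length D) 0 M) N))
  | skSort l a => (fun G P => P == mark l, fun G P M => fst (sem a) G M)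
  end.

Definition valid a := fst (sem a).
Definition elem a := snd (sem a).

Lemma valid_conv a G P P' : P == P' -> valid a G P -> valid a G P'.
Proof.
  intros HP. destruct a; unfold valid; simpl.
  - intros (A & ? & ?). exists A. eauto using conv_trans, conv_sym.
  - intros [? ?]. split; eauto using conv_trans, conv_sym.
  - intros (P1 & P2 & ? & ?). exists P1, P2. eauto using conv_trans, conv_sym.
  - eauto using conv_trans, conv_sym.
Qed.

Lemma elem_conv a : forall G P P' M M', P == P' -> M == M' -> elem a G P M -> elem a G P' M'.
Proof.
  induction a; intros G P P' M M' HP HM; unfold elem; simpl.
  - intros (A & M1 & ? & ? & ? & ?). exists A, M1.
    repeat split; eauto using conv_trans, conv_sym.
  - intros (M1 & ? & ?). exists M1. split; eauto using conv_trans, conv_sym.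
  - intros (P1 & P2 & ? & H). exists P1, P2. split; [eauto using conv_trans, conv_sym|].
    intros D N HN. eapply IHa2; [apply conv_refl| |apply H, HN].
    apply conv_app; auto using conv_refl, conv_lift.
  - now apply valid_conv.
Qed.

Lemma inst_lift_shift n (t : tm) r : lift n 0 (inst r t) = inst (fun i => lift n 0 (r i)) t.
Proof.
  rewrite lift0_inst, inst_inst. apply inst_ext. intros. now rewrite lift0_inst.
Qed.

Lemma inst1_weaken N n m (P : tm) :
  inst1 N n (inst (up (shift m)) P) = inst1 N (n + m) P.
Proof.
  rewrite inst_scons_up. apply inst_ext. intros [|i]; simpl; auto.
  unfold shift; simpl. f_equal; lia.
Qed.

Lemma lift_pi n (A B : tm) :
  lift n 0 (tPi A B) = tPi (lift n 0 A) (inst (up (shift n)) B).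
Proof. now rewrite !lift0_inst. Qed.

Lemma valid_weaken a G P D : valid a G P -> valid a (D ++ G) (lift (length D) 0 P).
Proof.
  revert G P D. induction a; intros G P D; unfold valid; simpl.
  - intros (A & ? & H). exists (lift (length D) 0 A). split; auto using conv_lift.
    apply (atyp_weaken ax rl no_sig _ conv_inst no_sig_closed D _ _ _ H).
  - intros [H ?]. split; auto. now apply (conv_lift _ _ (length D)) in H.
  - intros (P1 & P2 & H & H1 & H2).
    exists (lift (length D) 0 P1), (inst (up (shift (length D))) P2). repeat split.
    + rewrite <- lift_pi. now apply conv_lift.
    + now apply IHa1.
    + intros D' N HN. rewrite inst1_weaken, app_assoc, <- length_app. apply H2.
      now rewrite <- app_assoc, length_app, <- lift_lift.
  - intros H. apply (conv_lift _ _ (length D)) in H. now destruct l.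
Qed.

Lemma elem_weaken a G P M D : elem a G P M ->
  elem a (D ++ G) (lift (length D) 0 P) (lift (length D) 0 M).
Proof.
  destruct a; unfold elem; simpl.
  - intros (A & M' & ? & ? & H & H'). exists (lift (length D) 0 A), (lift (length D) 0 M').
    repeat split; auto using conv_lift.
    + apply (atyp_weaken ax rl no_sig _ conv_inst no_sig_closed D _ _ _ H).
    + apply (atyp_weaken ax rl no_sig _ conv_inst no_sig_closed D _ _ _ H').
  - intros (M' & ? & H). exists (lift (length D) 0 M'). split; auto using conv_lift.
    apply (atyp_weaken ax rl no_sig _ conv_inst no_sig_closed D _ _ _ H).
  - intros (P1 & P2 & H & H1).
    exists (lift (length D) 0 P1), (inst (up (shift (length D))) P2). split.
    + rewrite <- lift_pi. now apply conv_lift.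
    + intros D' N HN. rewrite inst1_weaken, app_assoc, lift_lift, <- length_app. apply H1.
      now rewrite <- app_assoc, length_app, <- lift_lift.
  - apply valid_weaken.
Qed.

(** * Proper shapes: uniqueness on PTS types, agreement on elements *)

Definition collapses (a b : skel) : Prop :=
  exists s1 s2 s3, a = skEl s1 /\ b = skEl s2 /\ rl s1 s2 s3.

(** The shapes of lambda-Pi types, as opposed to those of kinds. *)
Fixpoint object (a : skel) : Prop :=
  match a with
  | skArr a b => object b
  | skSort _ _ => False
  | _ => True
  end.

(** Forbids the function-space reading of any product which the specification makes a PTS type, and
    ties [LType] to object shapes. *)
Fixpoint proper (a : skel) : Prop :=
  match a with
  | skArr a b => object a /\ proper a /\ proper b /\ ~ collapses a b
  | skSort l a => proper a /\ (l = LType -> object a)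
  | _ => True
  end.

Lemma normal_mark l : normal (mark l).
Proof.
  intros N H. destruct l; repeat match goal with
  | H : beta_step _ _ |- _ => inversion H; subst; clear H
  | H : ctx_clos _ _ _ |- _ => inversion H; subst; clear H
  | H : beta_top _ _ |- _ => inversion H; subst; clear H
  end.
Qed.

Lemma untyped_mark G l T : ~ atypS G (mark l) T.
Proof.
  assert (H : forall T, ~ atypS G (mark LType) T).
  { intros T' H. destruct (gen_app _ _ _ _ H) as (A & B & H1 & _).
    destruct (gen_sort _ _ _ H1) as (s & _ & H2).
    now apply conv_sym, conv_pi_sort in H2. }
  destruct l; auto. intros HK. destruct (gen_app _ _ _ _ HK) as (A & B & H1 & _).
  now apply H in H1.
Qed.

Lemma mark_sort l s : ~ mark l == tSort s.
Proof.
  intros H. apply conv_normal_eq in H; auto using normal_mark, normal_sort.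
  now destruct l.
Qed.

Lemma mark_pi l A B : ~ mark l == tPi A B.
Proof.
  intros H. apply conv_sym, conv_normal_pi in H; auto using normal_mark.
  destruct H as (? & ? & ?). now destruct l.
Qed.

(** A mark is normal and untypable, and it is neither a sort nor a product, which rules out the
    other three clauses. *)
Lemma valid_mark a G l : valid a G (mark l) -> exists b, a = skSort l b.
Proof.
  destruct a as [s|s|a b|l' a]; unfold valid; simpl.
  - intros (A & H1 & H2). destruct (untyped_mark G l (tSort s)).
    eapply atyp_conv_normal; eauto using conv_sym, normal_mark.
  - intros [H _]. now apply mark_sort in H.
  - intros (P1 & P2 & H & _). now apply mark_pi in H.
  - intros H. apply conv_normal_eq in H; auto using normal_mark.
    exists a. now destruct l, l'.
Qed.

Lemma inst1_0 N (P : tm) : inst1 N 0 P = subst N 0 P.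
Proof.
  rewrite subst_inst. apply inst_ext. intros [|n]; simpl; auto.
  unfold shift. f_equal; lia.
Qed.

Lemma elem_var0 s G P A : P == A -> atypS G A (tSort s) ->
  elem (skEl s) (A :: G) (lift 1 0 P) (tVar 0).
Proof.
  intros H1 H2. exists (lift 1 0 A), (tVar 0).
  repeat split; auto using conv_lift, conv_refl.
  - apply (weaken1 _ _ _ _ H2).
  - apply atyp_var0.
Qed.

(** This is where the two readings of a product are kept apart. If [b] were an arrow, the typed
    components of a reduct of [A] would force both of its sides to be [skEl] shapes related by a
    rule, which properness excludes. A [skTop] sort has no type and a mark is untypable. *)
Lemma valid_El_unique b : forall s G P, proper b ->
  valid (skEl s) G P -> valid b G P -> b = skEl s.
Proof.
  induction b as [s'|s'|b1 IH1 b2 IH2|l b IH]; intros s G P Hb (A & HP & HA); unfold valid; simpl.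
  - intros (A' & HP' & HA'). f_equal. eapply atyp_unique_conv; eauto.
    eauto using conv_trans, conv_sym.
  - intros [HP' Hax]. exfalso.
    assert (H : atypS G (tSort s') (tSort s)).
    { eapply atyp_conv_normal; eauto using normal_sort, conv_trans, conv_sym. }
    destruct (gen_sort _ _ _ H) as (s'' & H' & _). now apply Hax in H'.
  - intros (P1 & P2 & HP' & H1 & H2). exfalso.
    destruct (atyp_conv_pi G A P1 P2 s) as (A1 & A2 & s1 & s2 & E1 & E2 & _ & _ & T1 & T2 & Hr);
      eauto using conv_trans, conv_sym.
    destruct Hb as (_ & Hb1 & Hb2 & Hn). apply Hn. exists s1, s2, s. repeat split; auto.
    + apply (IH1 s1 G P1); auto. exists A1. auto.
    + assert (V1 : valid (skEl s1) G P1) by (exists A1; auto).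
      assert (E := IH1 _ _ _ Hb1 V1 H1). subst b1.
      apply (IH2 s2 (A1 :: G) P2); auto.
      * exists A2; auto.
      (* The codomain is tested at a fresh variable of type [A1], which the context extensions in
         the arrow clause make available. *)
      * rewrite <- (inst_var0_shift P2). apply (H2 [A1] (tVar 0)).
        now apply elem_var0.
  - intros H. destruct (untyped_mark G l (tSort s)).
    eapply atyp_conv_normal; eauto using normal_mark, conv_trans, conv_sym.
Qed.

(** Proper shapes of one type can differ, since an arrow with an empty domain leaves its codomain
    shape unconstrained. They still determine the same elements, which is what comparing
    independently computed shapes requires. *)
Lemma elem_agree a : forall b G P, object a -> proper a -> proper b ->
  valid a G P -> valid b G P -> forall M, elem a G P M <-> elem b G P M.
Proof.
  induction a as [s|s|a1 IH1 a2 IH2|l a IH]; intros b G P Ho Ha Hb Va Vb M.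
  - now rewrite (valid_El_unique b s G P).
  - assert (E : b = skTop s); [|now rewrite E].
    destruct b as [s'|s'|b1 b2|l b].
    + symmetry. eapply valid_El_unique; eauto.
    + destruct Va as [H1 _], Vb as [H2 _]. f_equal. apply (@conv_sort_inj _ Empty_set).
      eauto using conv_trans, conv_sym.
    + destruct Va as [H1 _], Vb as (P1 & P2 & H2 & _).
      exfalso. apply (conv_pi_sort P1 P2 s). eauto using conv_trans, conv_sym.
    + destruct Va as [H1 _]. simpl in Vb.
      exfalso. apply (mark_sort l s). eauto using conv_trans, conv_sym.
  - destruct b as [s'|s'|b1 b2|l b].
    + now rewrite (valid_El_unique _ s' G P Ha Vb Va).
    + destruct Vb as [H1 _], Va as (P1 & P2 & H2 & _).
      exfalso. apply (conv_pi_sort P1 P2 s'). eauto using conv_trans, conv_sym.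
    + destruct Va as (P1 & P2 & EP & V1 & V2), Vb as (Q1 & Q2 & EQ & W1 & W2).
      destruct Ha as (? & ? & ? & _), Hb as (? & ? & ? & _).
      assert (E : tPi P1 P2 == tPi Q1 Q2) by eauto using conv_trans, conv_sym.
      apply conv_pi_inj in E as [E1 E2].
      (* The domains are compared first: validity of the codomains is known only at elements of the
         domain. *)
      assert (D1 : forall D N, elem a1 (D ++ G) (lift (length D) 0 P1) N <->
                               elem b1 (D ++ G) (lift (length D) 0 P1) N).
      { intros D N. apply IH1; auto; apply valid_weaken; auto.
        eapply valid_conv; [apply conv_sym, E1|auto]. }
      assert (D2 : forall D N Q, elem a1 (D ++ G) (lift (length D) 0 P1) N ->
        elem a2 (D ++ G) (inst1 N (length D) P2) Q <->
        elem b2 (D ++ G) (inst1 N (length D) P2) Q).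
      { intros D N Q HN. apply IH2; auto.
        - now apply V2.
        - eapply valid_conv; [apply conv_inst, conv_sym, E2|]. apply W2.
          eapply elem_conv; [apply conv_lift, E1|apply conv_refl|]. now apply D1. }
      split; intros (R1 & R2 & ER & H').
      * assert (E : tPi R1 R2 == tPi P1 P2) by eauto using conv_trans, conv_sym.
        apply conv_pi_inj in E as [F1 F2].
        exists P1, P2. split; auto. intros D N HN. apply D1 in HN. apply D2; auto.
        eapply elem_conv; [apply conv_inst, F2|apply conv_refl|]. apply H'.
        eapply elem_conv; [apply conv_lift, conv_sym, F1|apply conv_refl|auto].
      * assert (E : tPi R1 R2 == tPi P1 P2) by eauto using conv_trans, conv_sym.
        apply conv_pi_inj in E as [F1 F2].
        exists P1, P2. split; auto. intros D N HN. apply D2; auto.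
        eapply elem_conv; [apply conv_inst, F2|apply conv_refl|]. apply H'.
        eapply elem_conv; [apply conv_lift, conv_sym, F1|apply conv_refl|].
        now apply D1.
    + destruct Va as (P1 & P2 & H2 & _). simpl in Vb.
      exfalso. apply (mark_pi l P1 P2). eauto using conv_trans, conv_sym.
  - contradiction.
Qed.

(** * Products, abstractions and applications *)

(** The shape given to a product: the PTS reading takes precedence whenever a rule allows it. *)
Definition arrow (a b c : skel) : Prop :=
  (exists s1 s2 s3, a = skEl s1 /\ b = skEl s2 /\ rl s1 s2 s3 /\ c = skEl s3) \/
  (~ collapses a b /\ c = skArr a b).

Lemma arrow_ex a b : exists c, arrow a b c.
Proof.
  destruct (classic (collapses a b)) as [(s1 & s2 & s3 & ? & ? & ?)|H].
  - exists (skEl s3). left. eauto 8.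
  - exists (skArr a b). right. auto.
Qed.

Lemma arrow_proper a b c : arrow a b c -> object a -> proper a -> proper b -> proper c.
Proof.
  intros [(? & ? & ? & _ & _ & _ & ->)|[? ->]]; simpl; auto.
Qed.

Lemma arrow_object a b c : arrow a b c -> object b -> object c.
Proof.
  intros [(? & ? & ? & _ & _ & _ & ->)|[? ->]]; simpl; auto.
Qed.

(** In the collapsing case the codomain is evaluated at a fresh variable, which turns the semantic
    hypothesis into a typing of the open codomain. *)
Lemma valid_pi a b c G P1 P2 : arrow a b c -> valid a G P1 ->
  (forall D N, elem a (D ++ G) (lift (length D) 0 P1) N ->
     valid b (D ++ G) (inst1 N (length D) P2)) ->
  valid c G (tPi P1 P2).
Proof.
  intros [(s1 & s2 & s3 & -> & -> & Hr & ->)|[_ ->]] H1 H2.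
  - destruct H1 as (A1 & E1 & T1).
    destruct (H2 [A1] (tVar 0)) as (A2 & E2 & T2); [now apply elem_var0|].
    simpl in E2. rewrite inst_var0_shift in E2.
    exists (tPi A1 A2). split; auto using conv_pi. eapply at_pi; eauto.
  - exists P1, P2. auto using conv_refl.
Qed.

(** A collapsing product requires a typed abstraction, built from the body at a fresh variable; a
    function space requires only closure under beta-expansion. The annotation [Q] is kept apart from
    [P1] because erased constants match their types only up to conversion. *)
Lemma elem_lam a b c G P1 P2 Q M : arrow a b c -> valid a G P1 -> P1 == Q ->
  (forall D N, elem a (D ++ G) (lift (length D) 0 P1) N ->
     valid b (D ++ G) (inst1 N (length D) P2) /\
     elem b (D ++ G) (inst1 N (length D) P2) (inst1 N (length D) M)) ->
  elem c G (tPi P1 P2) (tLam Q M).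
Proof.
  intros [(s1 & s2 & s3 & -> & -> & Hr & ->)|[_ ->]] H1 HQ H2.
  - destruct H1 as (A1 & E1 & T1).
    destruct (H2 [A1] (tVar 0)) as (_ & A2 & M' & E2 & EM & T2 & TM);
      [now apply elem_var0|].
    simpl in E2, EM. rewrite inst_var0_shift in E2, EM.
    exists (tPi A1 A2), (tLam A1 M'). repeat split.
    + now apply conv_pi.
    + apply conv_lam; auto. eauto using conv_trans, conv_sym.
    + eapply at_pi; eauto.
    + eapply at_lam; eauto.
  - exists P1, P2. split; auto using conv_refl. intros D N HN.
    eapply elem_conv; [apply conv_refl| |apply H2, HN].
    rewrite lift0_inst. simpl. eapply conv_trans; [|apply conv_sym, conv_beta].
    rewrite subst_up. apply conv_refl.
Qed.

Lemma elem_app_arr a b G P1 P2 M N :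
  elem (skArr a b) G (tPi P1 P2) M -> elem a G P1 N ->
  elem b G (subst N 0 P2) (tApp M N).
Proof.
  intros (Q1 & Q2 & E & H) HN. apply conv_pi_inj in E as [E1 E2].
  specialize (H [] N). simpl in H. rewrite !lift_0, inst1_0 in H.
  eapply elem_conv; [|apply conv_refl|apply H].
  - rewrite !subst_inst. now apply conv_inst, conv_sym.
  - eapply elem_conv; [apply E1|apply conv_refl|auto].
Qed.

Lemma elem_app a b c G P1 P2 M N : arrow a b c -> valid a G P1 ->
  valid b G (subst N 0 P2) ->
  elem c G (tPi P1 P2) M -> elem a G P1 N -> elem b G (subst N 0 P2) (tApp M N).
Proof.
  intros [(s1 & s2 & s3 & -> & -> & Hr & ->)|[_ ->]] V1 V2 HM HN;
    [|eapply elem_app_arr; eauto].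
  destruct HM as (A & M' & EA & EM & TA & TM), HN as (B1 & N' & EB & EN & TB & TN).
  destruct (atyp_conv_pi G A P1 P2 s3) as (A1 & A2 & t1 & t2 & E1 & E2 & E & TP & T1 & T2 & _);
    auto using conv_sym.
  assert (TN' : atypS G N' A1) by (eapply at_conv; eauto using conv_trans, conv_sym).
  assert (T2' := subst_typ _ _ _ _ _ T2 TN').
  assert (EP : subst N 0 P2 == subst N' 0 A2).
  { rewrite !subst_inst. now apply conv_scons. }
  (* The codomain sort [t2] comes from a reduct of the function's type; validity of the instantiated
     codomain identifies it with [s2]. *)
  assert (Et : skEl s2 = skEl t2).
  { eapply valid_El_unique; simpl; eauto. exists (subst N' 0 A2). auto. }
  injection Et as ->.
  exists (subst N' 0 A2), (tApp M' N'). repeat split; auto using conv_app.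
  destruct (gen_pi _ _ _ _ TP) as (u1 & u2 & u3 & ? & ? & ? & ?).
  eapply at_app; eauto. eapply at_conv; eauto.
Qed.
(** * Erasure of the embedding *)

Notation ltm := (lterm Srt).
Notation atypL := (atyp lp_ax lp_rl (sigS ax rl) (betaR_conv ax rl)).

(* The inverse of the translation on untyped terms.  [cEps] becomes an identity function
   and [cPi] a product former, so that the rules of [RS_top] become beta-conversions. *)
Fixpoint erase (t : ltm) : tm :=
  match t with
  | tSort l => mark l
  | tVar n => tVar n
  | tApp M N => tApp (erase M) (erase N)
  | tLam A M => tLam (erase A) (erase M)
  | tPi A B => tPi (erase A) (erase B)
  | tConst (cU s) => tSort s
  | tConst (cEps s) => tLam (tSort s) (tVar 0)
  | tConst (cDot s) => tSort s
  | tConst (cPi s1 s2 s3) =>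
      tLam (tSort s1) (tLam (tPi (tVar 0) (tSort s2))
        (tPi (tVar 1) (tApp (tVar 1) (tVar 0))))
  end.

Lemma erase_lift n t : forall k, erase (lift n k t) = lift n k (erase t).
Proof.
  induction t; intros k; simpl; rewrite ?IHt1, ?IHt2; auto.
  - now destruct s.
  - now destruct (k <=? n0).
  - now destruct c.
Qed.

Lemma erase_inst t : forall r, erase (inst r t) = inst (fun n => erase (r n)) (erase t).
Proof.
  assert (U : forall r n, erase (up r n) = up (fun n => erase (r n)) n).
  { intros r [|n]; simpl; auto using erase_lift. }
  induction t; intros r; simpl; rewrite ?IHt1, ?IHt2; auto.
  - now destruct s.
  - f_equal. apply inst_ext, U.
  - f_equal. apply inst_ext, U.
  - now destruct c.
Qed.

Lemma erase_subst N t : erase (subst N 0 t) = subst (erase N) 0 (erase t).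
Proof.
  rewrite !subst_inst, erase_inst. apply inst_ext. now intros [|n].
Qed.

Lemma conv_id (A N : tm) : tApp (tLam A (tVar 0)) N == N.
Proof. eapply conv_trans; [apply conv_beta|]. simpl. rewrite lift_0. apply conv_refl. Qed.

Lemma erase_cPi s1 s2 s3 A : tApp (erase (cst (cPi s1 s2 s3))) A ==
  tLam (tPi A (tSort s2)) (tPi (lift 1 0 A) (tApp (tVar 1) (tVar 0))).
Proof. eapply conv_trans; [apply conv_beta|]. simpl. rewrite lift_0. apply conv_refl. Qed.

Lemma erase_cPi_app s1 s2 s3 A B : tApp (tApp (erase (cst (cPi s1 s2 s3))) A) B ==
  tPi A (tApp (lift 1 0 B) (tVar 0)).
Proof.
  eapply conv_trans; [apply conv_app; [apply (erase_cPi s1 s2 s3)|apply conv_refl]|].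
  eapply conv_trans; [apply conv_beta|]. simpl.
  rewrite subst_inst, inst_scons_shift, inst_id by auto. apply conv_refl.
Qed.

Lemma erase_conv M N : betaR_conv ax rl M N -> erase M == erase N.
Proof.
  induction 1; eauto using conv_refl, conv_sym, conv_trans.
  induction H; simpl; auto using conv_app, conv_lam, conv_pi, conv_refl.
  destruct H as [H|H]; destruct H; simpl.
  - rewrite erase_subst. apply conv_beta.
  - apply conv_id.
  - eapply conv_trans; [apply conv_id|]. eapply conv_trans; [apply (erase_cPi_app s1 s2 s3)|].
    rewrite erase_lift. apply conv_sym, conv_pi; apply conv_id.
Qed.

Lemma ctx_clos_inst (R : ltm -> ltm -> Prop) :
  (forall M N r, R M N -> R (inst r M) (inst r N)) ->
  forall M N, ctx_clos R M N -> forall r, ctx_clos R (inst r M) (inst r N).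
Proof.
  intros HR. induction 1; intros r; simpl.
  - apply cc_top; auto.
  - apply cc_appl; auto.
  - apply cc_appr; auto.
  - apply cc_laml; auto.
  - apply cc_lamr; auto.
  - apply cc_pil; auto.
  - apply cc_pir; auto.
Qed.

Lemma betaR_conv_stable (M N : ltm) r :
  betaR_conv ax rl M N -> betaR_conv ax rl (inst r M) (inst r N).
Proof.
  intros H. revert r.
  induction H; intros r; [|apply rst_refl|now apply rst_sym, IHclos_refl_sym_trans|
    eapply rst_trans; [apply IHclos_refl_sym_trans1|apply IHclos_refl_sym_trans2]].
  apply rst_step. apply ctx_clos_inst; auto. clear.
  intros M N r [[A M' N']|H].
  - left. rewrite inst_subst. apply beta_redex.
  - right. destruct H; simpl.
    + now constructor.
    + rewrite up_lift. now constructor.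
Qed.

Lemma sigS_closed c (A : ltm) r : sigS ax rl c A -> inst r A = A.
Proof. now destruct 1. Qed.

Lemma sigS_typed c (A : ltm) : sigS ax rl c A ->
  (exists l, A = tSort l) \/ exists l, atypL [] A (tSort l).
Proof.
  assert (U : forall D s, atypL D (cst (cU s)) (tSort LType)).
  { intros. apply at_const, sig_u. }
  assert (K : forall D, atypL D (tSort LType) (tSort LKind)).
  { intros. apply at_sort, lp_ax_type. }
  destruct 1; eauto; right.
  - exists LKind. eapply at_pi; eauto using lp_rl_tk.
  - exists LType. eapply at_pi; [apply U| |apply lp_rl_tt].
    eapply at_pi; [|apply U|apply lp_rl_tt].
    eapply at_pi; [|apply U|apply lp_rl_tt].
    change (tSort LType : ltm) with (subst (tVar 0) 0 (tSort LType : ltm)).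
    eapply at_app; [apply U|apply K|apply lp_rl_tk|apply at_const, sig_eps|].
    now apply (at_var _ _ _ _ _ 0 (cst (cU s1))).
Qed.

Scheme trans_min := Minimality for trans Sort Prop
  with ttrans_min := Minimality for ttrans Sort Prop.
Combined Scheme trans_ttrans_min from trans_min, ttrans_min.

Lemma trans_erase : (forall G M M', trans ax rl G M M' -> erase M' == M) /\
  (forall G A A', ttrans ax rl G A A' -> erase A' == A).
Proof.
  apply trans_ttrans_min; intros; simpl; auto using conv_refl, conv_app, conv_lam, conv_pi.
  (* The erased product applies the family to its bound variable; one beta step removes the
     abstraction inserted by the translation. *)
  - eapply conv_trans; [apply (erase_cPi_app s1 s2 s3)|]. apply conv_pi; auto.
    eapply conv_trans; [|apply H7]. rewrite lift0_inst. simpl.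
    eapply conv_trans; [apply conv_beta|].
    rewrite subst_up, inst_var0_shift. apply conv_refl.
  - eapply conv_trans; [apply conv_id|auto].
Qed.
(** * The fundamental theorem *)

Section Fundamental.
Implicit Types (D : list ltm) (E : list tm -> (nat -> tm) -> Prop).

(* [E] is a set of environments for [D].  Each variable has the same shape in all of them,
   so that shapes are not affected by substitution. *)
Definition interprets D E : Prop :=
  (forall G r, E G r -> forall X, E (X ++ G) (fun n => lift (length X) 0 (r n))) /\
  forall n A, nth_error D n = Some A -> exists a, object a /\ proper a /\
    forall G r, E G r -> valid a G (inst r (erase (lift (S n) 0 A))) /\
                         elem a G (inst r (erase (lift (S n) 0 A))) (r n).

(** The environment is compared pointwise, which avoids function extensionality. *)
Definition extend E a (A : ltm) G r : Prop :=
  exists N r', E G r' /\ elem a G (inst r' (erase A)) N /\ forall n, r n = scons N r' n.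

Lemma interprets_extend D E a A : interprets D E -> object a -> proper a ->
  (forall G r, E G r -> valid a G (inst r (erase A))) -> interprets (A :: D) (extend E a A).
Proof.
  intros [H1 H2] Ho Hp HA. split.
  - intros G r (N & r' & Hr & HN & Hrr) X.
    exists (lift (length X) 0 N), (fun n => lift (length X) 0 (r' n)). repeat split; auto.
    + rewrite <- inst_lift_shift. now apply elem_weaken.
    + intros [|n]; now rewrite Hrr.
  - assert (HI : forall G r (B : ltm) k, extend E a A G r -> exists N r', E G r' /\
      elem a G (inst r' (erase A)) N /\ (r 0 = N /\ forall n, r (S n) = r' n) /\
      inst r (erase (lift (S k) 0 B)) = inst r' (erase (lift k 0 B))).
    { intros G r B k (N & r' & Hr & HN & Hrr). exists N, r'.
      split; [auto|split; [auto|split]].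
      - split; [apply (Hrr 0)|intros n; apply (Hrr (S n))].
      - rewrite lift_S, (erase_lift 1), (inst_ext _ _ _ Hrr). apply inst_scons_shift. }
    intros [|n] B HB; simpl in HB.
    + injection HB as <-. exists a. split; [|split]; auto. intros G r Hr.
      destruct (HI G r A 0 Hr) as (N & r' & Hr' & HN & [<- _] & ->).
      rewrite lift_0. auto.
    + destruct (H2 _ _ HB) as (b & ? & ? & Hb). exists b. split; [|split]; auto.
      intros G r Hr.
      destruct (HI G r B (S n) Hr) as (N & r' & Hr' & HN & [_ Hn] & ->).
      rewrite Hn. auto.
Qed.

Lemma extend_intro D E a A G r X N : interprets D E -> E G r ->
  elem a (X ++ G) (lift (length X) 0 (inst r (erase A))) N ->
  extend E a A (X ++ G) (scons N (fun n => lift (length X) 0 (r n))).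
Proof.
  intros [H1 _] Hr HN. exists N, (fun n => lift (length X) 0 (r n)).
  repeat split; auto. now rewrite <- inst_lift_shift.
Qed.

Lemma inst1_up N n r (t : tm) :
  inst1 N n (inst (up r) t) = inst (scons N (fun i => lift n 0 (r i))) t.
Proof.
  rewrite inst_scons_up. apply inst_ext. intros [|i]; simpl; auto. now rewrite lift0_inst.
Qed.

(** The shape is chosen before the context and the environment, so that one shape of an open
    codomain serves all its instances. The set [E] is arbitrary because it grows under binders. *)
Definition holds D (M T : ltm) : Prop := forall E, interprets D E ->
  exists a, proper a /\ forall G r, E G r ->
    valid a G (inst r (erase T)) /\ elem a G (inst r (erase T)) (inst r (erase M)).

Lemma inst_mark r l : inst r (mark l) = mark l.
Proof. now destruct l. Qed.

Lemma holds_sort D E M l : holds D M (tSort l) -> interprets D E ->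
  exists a, proper (skSort l a) /\ forall G r, E G r -> valid a G (inst r (erase M)).
Proof.
  intros H HE. destruct (H E HE) as (b & Hp & Hb).
  destruct (classic (exists G r, E G r)) as [(G & r & Hr)|HN].
  - destruct (Hb _ _ Hr) as [Hv _]. simpl in Hv. rewrite inst_mark in Hv.
    destruct (valid_mark _ _ _ Hv) as [a ->]. exists a. split; auto.
    intros G' r' Hr'. now apply Hb.
  (* Without any environment the validity claim is vacuous, and any proper object shape will do. *)
  - exists (skTop s0). split; simpl; auto. intros G r Hr. destruct HN. eauto.
Qed.

Definition sort_skel s a : Prop :=
  (exists s', ax s s' /\ a = skEl s') \/ ((forall s', ~ ax s s') /\ a = skTop s).

Lemma sort_skel_ex s : exists a, sort_skel s a.
Proof.
  destruct (classic (exists s', ax s s')) as [[s' H]|H].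
  - exists (skEl s'). left. eauto.
  - exists (skTop s). right. split; auto. intros s' Hs. eauto.
Qed.

Lemma sort_skel_proper s a : sort_skel s a -> object a /\ proper a.
Proof. now intros [(? & _ & ->)|[_ ->]]. Qed.

Lemma valid_sort s a G : sort_skel s a -> valid a G (tSort s).
Proof.
  intros [(s' & H & ->)|[H ->]].
  - exists (tSort s). split; [apply conv_refl|now apply at_sort].
  - split; auto using conv_refl.
Qed.

Lemma elem_sort s a G M : sort_skel s a ->
  elem a G (tSort s) M <-> exists M', M == M' /\ atypS G M' (tSort s).
Proof.
  intros [(s' & H & ->)|[H ->]]; [|reflexivity]. split.
  - intros (A & M' & HA & HM & TA & TM). exists M'. split; auto.
    apply at_conv with A s'; auto; [now apply at_sort|now apply conv_sym].
  - intros (M' & HM & TM). exists (tSort s), M'.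
    repeat split; auto using conv_refl. now apply at_sort.
Qed.

(** The family given to [cPi] is an element of a product from a type [a] to the sort [s2], which may
    collapse or not. In both readings its value at a fresh variable of type [a] is convertible to a
    typed [b], and the product of [a] and [b] is typed by the rule. *)
Lemma elem_cPi s1 s2 s3 c1 c2 c3 d e f G P :
  rl s1 s2 s3 -> sort_skel s1 c1 -> sort_skel s2 c2 -> sort_skel s3 c3 ->
  arrow (skEl s1) c2 d -> arrow d c3 e -> arrow c1 e f ->
  P = tPi (tSort s1) (tPi (tPi (tApp (tLam (tSort s1) (tVar 0)) (tVar 0)) (tSort s2))
        (tSort s3)) ->
  valid f G P /\ elem f G P (erase (cst (cPi s1 s2 s3))).
Proof.
  intros Hr H1 H2 H3 Hd He Hf ->.
  assert (Vd : forall G a, atypS G a (tSort s1) -> valid d G (tPi a (tSort s2))).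
  { intros G' a Ha. eapply valid_pi; eauto.
    - exists a. auto using conv_refl.
    - intros. now apply valid_sort. }
  assert (Ve : forall G N a, N == a -> atypS G a (tSort s1) -> valid e G
      (tPi (tPi (tApp (tLam (tSort s1) (tVar 0)) N) (tSort s2)) (tSort s3))).
  { intros G' N a Ea Ha. eapply valid_pi; eauto.
    - eapply valid_conv; [|apply Vd, Ha].
      apply conv_pi; auto using conv_refl. eapply conv_trans; [|apply conv_sym, conv_id].
      now apply conv_sym.
    - intros. now apply valid_sort. }
  assert (HN : forall X N, elem c1 (X ++ G) (lift (length X) 0 (tSort s1)) N ->
    exists a, N == a /\ atypS (X ++ G) a (tSort s1)).
  { intros X N HN. now apply (elem_sort s1) in HN. }
  split.
  - eapply valid_pi; eauto using valid_sort.
    intros X N H. destruct (HN _ _ H) as (a & Ea & Ha). simpl. eapply Ve; eauto.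
  - eapply elem_lam; eauto using valid_sort, conv_refl.
    intros X N H. destruct (HN _ _ H) as (a & Ea & Ha). simpl.
    split; [eapply Ve; eauto|].
    assert (E : tPi (tApp (tLam (tSort s1) (tVar 0)) N) (tSort s2) == tPi a (tSort s2)).
    { apply conv_pi; auto using conv_refl. eapply conv_trans; [apply conv_id|auto]. }
    eapply elem_lam; eauto.
    + eapply valid_conv; [apply conv_sym, E|now apply Vd].
    + apply conv_pi; auto using conv_refl, conv_id.
    + intros X' B HB. simpl. split; [now apply valid_sort|].
      apply (elem_sort s3); auto.
      assert (Ha' := atyp_weaken ax rl no_sig _ conv_inst no_sig_closed X' _ _ _ Ha).
      simpl in Ha'. set (a' := lift (length X') 0 a) in *.
      set (G' := X' ++ X ++ G) in *.
      assert (HB' : elem d (a' :: G') (tPi (lift 1 0 a') (tSort s2)) (lift 1 0 B)).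
      { apply (elem_weaken d G' (tPi a' (tSort s2)) B [a']).
        exact (elem_conv _ _ _ _ _ _ (conv_lift _ _ (length X') E) (conv_refl _) HB). }
      assert (HV : elem c2 (a' :: G') (tSort s2) (tApp (lift 1 0 B) (tVar 0))).
      { eapply (elem_app _ _ _ _ _ (tSort s2)); eauto.
        - apply (valid_weaken (skEl s1) G' a' [a']). exists a'. auto using conv_refl.
        - now apply valid_sort.
        - apply (elem_var0 s1); auto using conv_refl. }
      apply (elem_sort s2) in HV; auto. destruct HV as (b & Eb & Hb).
      exists (tPi a' b). split; [|eapply at_pi; eauto].
      apply conv_pi; auto.
      rewrite inst_scons_shift, <- lift0_inst. now apply conv_lift.
Qed.

Lemma fundamental D M T : atypL D M T -> holds D M T.
Proof.
  induction 1; intros E HE.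
  - destruct (proj2 HE _ _ H) as (a & _ & Hp & Ha). exists a. auto.
  - destruct H; simpl.
    + destruct (sort_skel_ex s) as [c Hc]. exists (skSort LType c).
      destruct (sort_skel_proper _ _ Hc). split; [simpl; auto|]. intros W r _. split.
      * apply conv_refl.
      * now apply (valid_sort s).
    (* An element of the sort [s] is convertible to a PTS type of sort [s], so [cEps s] sends it to
       a valid type of shape [skEl s]. *)
    + destruct (sort_skel_ex s) as [c Hc]. exists (skArr c (skSort LType (skEl s))).
      destruct (sort_skel_proper _ _ Hc). split.
      * simpl. repeat split; auto. intros (? & ? & ? & ? & ? & ?). discriminate.
      * intros W r _. split; exists (tSort s), (mark LType).
        -- split; [apply conv_refl|]. split; [now apply valid_sort|].
           intros. apply conv_refl.
        -- split; [apply conv_refl|]. intros X N HN. apply (elem_sort s) in HN; auto.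
           destruct HN as (N' & EN & HN). exists N'. split; auto.
           eapply conv_trans; [apply conv_id|auto].
    + destruct (sort_skel_ex s2) as [c Hc]. exists c. split; [now apply (sort_skel_proper s2)|].
      intros W r _. split; [now apply valid_sort|]. apply (elem_sort s2); auto.
      exists (tSort s1). split; [apply conv_refl|now apply at_sort].
    + destruct (sort_skel_ex s1) as [c1 H1], (sort_skel_ex s2) as [c2 H2],
        (sort_skel_ex s3) as [c3 H3].
      destruct (arrow_ex (skEl s1) c2) as [d Hd], (arrow_ex d c3) as [e He],
        (arrow_ex c1 e) as [f Hf].
      destruct (sort_skel_proper _ _ H1), (sort_skel_proper _ _ H2),
        (sort_skel_proper _ _ H3).
      exists f. split.
      * eapply arrow_proper; eauto. eapply arrow_proper; eauto using arrow_object.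
        eapply arrow_proper; eauto; exact I.
      * intros W r _. eapply elem_cPi; eauto.
  (* The inner [skTop s0] is a filler: validity at a [skSort] shape only compares the type with a
     mark. *)
  - destruct H. exists (skSort LKind (skSort LType (skTop s0))). split.
    + simpl. repeat split; auto; discriminate.
    + intros W r _. split; apply conv_refl.
  - destruct (holds_sort _ _ _ _ IHatyp1 HE) as (a & [Pa Oa] & Va).
    (* Every lambda-Pi rule takes its domain in [LType], so the domain has an object shape and can
       extend the environments. *)
    assert (s1 = LType) as -> by now destruct H1.
    specialize (Oa eq_refl).
    destruct (holds_sort _ _ _ _ IHatyp2 (interprets_extend _ _ a A HE Oa Pa Va))
      as (b & [Pb Ob] & Vb).
    destruct (arrow_ex a b) as [c Hc]. exists (skSort s3 c).
    assert (s3 = s2) as -> by now destruct H1. split.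
    + split; eauto using arrow_proper, arrow_object.
    + intros W r Hr. simpl. rewrite inst_mark. split; [apply conv_refl|].
      eapply (valid_pi a b c); eauto. intros X N HN. rewrite inst1_up.
      eapply Vb, extend_intro; eauto.
  - destruct (holds_sort _ _ _ _ IHatyp1 HE) as (a & [Pa Oa] & Va).
    assert (s1 = LType) as -> by now destruct H1.
    specialize (Oa eq_refl).
    destruct (IHatyp3 _ (interprets_extend _ _ a A HE Oa Pa Va)) as (b & Pb & Vb).
    destruct (arrow_ex a b) as [c Hc]. exists c. split; [eauto using arrow_proper|].
    assert (Hext : forall W r, E W r -> forall X N,
      elem a (X ++ W) (lift (length X) 0 (inst r (erase A))) N ->
      valid b (X ++ W) (inst1 N (length X) (inst (up r) (erase B))) /\
      elem b (X ++ W) (inst1 N (length X) (inst (up r) (erase B)))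
        (inst1 N (length X) (inst (up r) (erase M)))).
    { intros W r Hr X N HN. rewrite !inst1_up. eapply Vb, extend_intro; eauto. }
    intros W r Hr. simpl. split.
    + eapply valid_pi; eauto. intros. now apply Hext.
    + eapply elem_lam; eauto using conv_refl.
  - destruct (holds_sort _ _ _ _ IHatyp1 HE) as (a & [Pa Oa] & Va).
    assert (s1 = LType) as -> by now destruct H1.
    specialize (Oa eq_refl).
    destruct (holds_sort _ _ _ _ IHatyp2 (interprets_extend _ _ a A HE Oa Pa Va))
      as (b & [Pb Ob] & Vb).
    (* The shapes [a] and [b] come from the product, [c] from the function and [a'] from the
       argument. They are computed independently and have to be reconciled. *)
    destruct (IHatyp3 _ HE) as (c & Pc & Hc), (IHatyp4 _ HE) as (a' & Pa' & Ha').
    assert (Hext : forall W r, E W r -> forall X N,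
      elem a (X ++ W) (lift (length X) 0 (inst r (erase A))) N ->
      valid b (X ++ W) (inst1 N (length X) (inst (up r) (erase B)))).
    { intros W r Hr X N' HN. rewrite inst1_up. eapply Vb, extend_intro; eauto. }
    assert (HN : forall W r, E W r -> elem a W (inst r (erase A)) (inst r (erase N))).
    { intros W r Hr. apply (elem_agree a a'); auto; now apply Ha'. }
    assert (HB : forall W r, E W r ->
      valid b W (subst (inst r (erase N)) 0 (inst (up r) (erase B)))).
    { intros W r Hr. rewrite <- inst1_0. apply (Hext W r Hr []).
      simpl. rewrite lift_0. auto. }
    assert (HS : forall r, inst r (erase (subst N 0 B)) =
      subst (inst r (erase N)) 0 (inst (up r) (erase B))).
    { intros r. now rewrite erase_subst, inst_subst. }
    assert (Hpi : forall c', arrow a b c' -> forall W r, E W r ->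
      valid c' W (inst r (erase (tPi A B)))).
    { intros c' Hc' W r Hr. simpl. eapply valid_pi; eauto. }
    destruct c as [s|s|a1 b1|l c].
    + exists b. split; auto. intros W r Hr. rewrite HS. split; auto. simpl.
      (* The product receives a second shape [c'] from [a] and [b]; uniqueness on PTS types equates
         it with [skEl s], so [elem_app] applies. *)
      destruct (arrow_ex a b) as [c' Hc'].
      destruct (Hc _ _ Hr) as [Vc Ec].
      assert (Pc' : proper c') by eauto using arrow_proper.
      assert (c' = skEl s) as -> by (eapply valid_El_unique; eauto).
      eapply elem_app; eauto.
    (* A product is not convertible to a sort, so there is no environment here and [b] is a
       filler. *)
    + exists b. split; auto. intros W r Hr. destruct (Hc _ _ Hr) as [[HP _] _].
      now apply conv_pi_sort in HP.
    (* The result takes the codomain shape [b1] of the function, which may differ from [b]; only the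
       argument is moved from [a] to [a1]. *)
    + destruct Pc as (O1 & P1 & P2 & _). exists b1. split; auto.
      intros W r Hr. rewrite HS. simpl.
      destruct (Hc _ _ Hr) as [(Q1 & Q2 & EQ & V1 & V2) Ec].
      apply conv_pi_inj in EQ as [E1 E2].
      assert (HN1 : elem a1 W (inst r (erase A)) (inst r (erase N))).
      { apply (elem_agree a1 a W (inst r (erase A))); auto.
        eapply valid_conv; [apply conv_sym, E1|auto]. }
      split; [|now apply (elem_app_arr a1 _ _ (inst r (erase A)))].
      rewrite <- inst1_0. eapply valid_conv; [apply conv_inst, conv_sym, E2|].
      apply (V2 []). simpl. rewrite lift_0.
      eapply elem_conv; [apply E1|apply conv_refl|auto].
    + exists b. split; auto. intros W r Hr. destruct (Hc _ _ Hr) as [HP _].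
      now apply conv_sym, mark_pi in HP.
  - destruct (IHatyp1 _ HE) as (a & Pa & Ha). exists a. split; auto.
    intros W r Hr. destruct (Ha _ _ Hr).
    assert (EA : inst r (erase A) == inst r (erase B)) by now apply conv_inst, erase_conv.
    split; [eapply valid_conv; eauto|eapply elem_conv; eauto using conv_refl].
Qed.


(** * From reducibility back to typability *)

Lemma ctrans_lookup G D : ctrans ax rl G D -> awf ax rl no_sig beta_conv G ->
  forall n A', nth_error D n = Some A' -> exists A s,
    nth_error G n = Some A /\ erase A' == A /\ atypS G (lift (S n) 0 A) (tSort s).
Proof.
  induction 1 as [|G D B B' HG IH HB]; intros HW [|n] A' HA'; try discriminate;
    inversion HW as [|? ? s HW' Hs]; subst; simpl in HA'.
  - injection HA' as <-. exists B, s. split; [auto|split].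
    + now apply (proj2 trans_erase G).
    + apply (weaken1 _ _ _ _ Hs).
  - destruct (IH HW' _ _ HA') as (A & s' & ? & ? & HA). exists A, s'.
    split; [auto|split; [auto|]].
    rewrite lift_S. apply (weaken1 _ _ _ _ HA).
Qed.

(** The canonical environments are the weakenings of the identity. Each variable is an element of
    shape [skEl s], because its erased type is convertible to the declared PTS type. *)
Lemma interprets_ctrans G D : ctrans ax rl G D -> awf ax rl no_sig beta_conv G ->
  interprets D (fun W r => exists X, W = X ++ G /\ forall n, r n = shift (length X) n).
Proof.
  intros HD HG. split.
  - intros W r (X & -> & Hr) Y. exists (Y ++ X). split; [apply app_assoc|].
    intros n. rewrite Hr, lift0_inst. unfold shift. simpl. f_equal.
    rewrite length_app. lia.
  - intros n A' HA'.
    destruct (ctrans_lookup _ _ HD HG _ _ HA') as (A & s & HA & EA & TA).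
    exists (skEl s). split; [exact I|split; [exact I|]]. intros W r (X & -> & Hr).
    assert (HV : elem (skEl s) (X ++ G) (lift (length X) 0 (erase (lift (S n) 0 A')))
      (lift (length X) 0 (tVar n))).
    { apply elem_weaken. exists (lift (S n) 0 A), (tVar n).
      rewrite erase_lift. repeat split; auto using conv_lift, conv_refl. now apply at_var. }
    rewrite (inst_ext _ _ _ Hr), <- lift0_inst, Hr. split; auto.
    destruct HV as (B & _ & ? & _ & ? & _). exists B. auto.
Qed.

(** At the identity environment the erasure of [N] is an element of a type convertible to [A]. A
    sort for [A] forces the shape [skEl s]; when [A] is a sort without a type, the elements agree
    with those of [skTop]. Either clause exhibits a typed inhabitant. *)
Lemma inhabited_of_translation G D A A' N :
  awf ax rl no_sig beta_conv G ->
  (exists s, atypS G A (tSort s)) \/ (exists s, A = tSort s) ->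
  ctrans ax rl G D -> ttrans ax rl G A A' -> atypL D N A' ->
  exists M, atypS G M A.
Proof.
  intros HG HA HD HA' HN.
  destruct (fundamental _ _ _ HN _ (interprets_ctrans _ _ HD HG)) as (a & Pa & Ha).
  destruct (Ha G (shift 0)) as [HV HE]; [now exists []|].
  assert (EA : inst (shift 0) (erase A') == A).
  { rewrite <- lift0_inst, lift_0. now apply (proj2 trans_erase G). }
  apply (valid_conv _ _ _ _ EA) in HV.
  apply (elem_conv _ _ _ _ _ _ EA (conv_refl _)) in HE.
  assert (H : forall s, atypS G A (tSort s) -> exists M, atypS G M A).
  { intros s TA. assert (a = skEl s) as ->.
    { eapply valid_El_unique; eauto. exists A. auto using conv_refl. }
    destruct HE as (B & M & ? & _ & _ & ?). exists M.
    eapply at_conv; eauto using conv_sym. }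
  destruct HA as [[s TA]|[s ->]]; eauto.
  destruct (sort_skel_ex s) as [b [(s' & Hs & ->)|[Hs ->]]].
  - apply (H s'). now apply at_sort.
  - assert (He : elem (skTop s) G (tSort s) (inst (shift 0) (erase N))).
    { apply (elem_agree (skTop s) a G (tSort s)); simpl; auto. now split; [apply conv_refl|]. }
    destruct He as (M & _ & HM). eauto.
Qed.

End Fundamental.
End PTS.

Theorem theorem5p24 (Srt : Type) (ax : Srt -> Srt -> Prop) (rl : Srt -> Srt -> Srt -> Prop) :
  functional ax rl ->
  forall (G : list (pterm Srt)) (A : pterm Srt),
    is_Gamma_type ax rl G A ->
    forall (G' : list (lterm Srt)) (A' N : lterm Srt),
      ctrans ax rl G G' -> ttrans ax rl G A A' ->
      typLP ax rl G' N A' ->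
      exists M : pterm Srt, typS ax rl G M A.
Proof.
  intros Hf G A [HG HA] G' A' N HG' HA' HN.
  destruct (typ_wf_atyp ax rl no_sig beta_conv) as [toS wfS_awf];
    [apply conv_inst|apply no_sig_closed|intros []|].
  destruct (typ_wf_atyp lp_ax lp_rl (sigS ax rl) (betaR_conv ax rl)) as [toL _];
    [apply betaR_conv_stable|apply sigS_closed|apply sigS_typed|].
  (* [A] has a sort or is one, which provides the sort from which the marks are built. *)
  assert (s0 : exists s0 : Srt, True) by (destruct HA as [[s _]|[s _]]; eauto).
  destruct s0 as [s0 _].
  destruct (inhabited_of_translation ax rl Hf s0 G G' A A' N) as [M HM]; auto.
  - destruct HA as [[s Hs]|]; [left; exists s; now apply toS|auto].
  - now apply toL.
  - exists M. now apply atyp_typ.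
Qed.
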